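(* Consider a two-qubit fermionic unitary $V$ (i.e. $V$ commutes with $Z\otimes Z$), the 4-qubit Gaussian state $|g\rangle=|\psi^+\rangle\otimes|\psi^+\rangle$ with $|\psi^+\rangle=(|00\rangle+|11\rangle)/\sqrt2$, and suppose $$|v\rangle=(I\otimes V\otimes I)|g\rangle=\sum_{j=1}^\chi c_j|g_j\rangle,$$ where $c_j\in\mathbb{C}$ and $|g_j\rangle=(I\otimes K_j\otimes I)|g\rangle$ with $K_j\in G_2$, $j=1,\dots,\chi$, two-qubit Gaussian unitaries. Then the following hold: 1) $V^{\otimes t}=\left(\sum_{j=1}^\chi c_jK_j\right)^{\otimes t}$ and $\xi(V^{\otimes t})\le\|c\|_1^{2t}$ for $t\in\mathbb{N}$. 2) If the decomposition $|v\rangle=\sum_{j=1}^\chi c_j|g_j\rangle$ is optimal with respect to the state extent, i.e. $\xi(|v\rangle)=\|c\|_1^2$, then $\xi(V)=\xi(|v\rangle)$. Furthermore, $\xi(V^{\otimes t})=\xi(V)^t$ for $t\in\mathbb{N}$.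
   Context: On $n$ qubits let $c_{2j-1}=Z^{\otimes(j-1)}\otimes X\otimes I^{\otimes(n-j)}$ and $c_{2j}=Z^{\otimes(j-1)}\otimes Y\otimes I^{\otimes(n-j)}$, $j=1,\dots,n$. The set $G_n$ of Gaussian unitaries consists of the $n$-qubit unitaries $U$ for which there is $R\in O(2n)$ with $Uc_jU^\dagger=\sum_kR_{j,k}c_k$ for all $j$. Pure Gaussian states: $\mathcal{G}_n=\{U|0\rangle^{\otimes n}:U\in G_n\}$. Unitary extent of an $n$-qubit unitary: $\xi(U)=\min\{\|c\|_1^2:U=\sum_jc_jK_j,\ K_j\in G_n,\ c_j\in\mathbb{C}\}$. State extent of an $n$-qubit pure state: $\xi(|\psi\rangle)=\min\{\|c\|_1^2:|\psi\rangle=\sum_jc_j|\phi_j\rangle,\ |\phi_j\rangle\in\mathcal{G}_n,\ c_j\in\mathbb{C}\}$. Here $\|c\|_1=\sum_j|c_j|$. In $|v\rangle$ and $|g_j\rangle$ the two-qubit unitary acts on qubits 2 and 3 of the four qubits. *)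

(* Defs.v *)
From HB Require Import structures.
From mathcomp Require Import all_boot all_order all_algebra.
From mathcomp Require Import complex mxtens.
From mathcomp Require Import all_classical all_reals.

Set Implicit Arguments.
Unset Strict Implicit.
Unset Printing Implicit Defensive.

Import Order.TTheory GRing.Theory Num.Theory.

Local Open Scope ring_scope.
Local Open Scope complex_scope.
Local Open Scope classical_set_scope.

(* Tensor products are the Kronecker products [*t] and [ntensmx], so that the
   first qubit is the most significant bit of a computational basis index. *)
Notation qop R n := 'M[R[i]]_(2 ^ n).
Notation qvec R n := 'cV[R[i]]_(2 ^ n).

Section Qubits.
Variable R : realType.
Local Notation C := R[i].

Definition adjoint m n (A : 'M[C]_(m, n)) : 'M[C]_(n, m) :=
  map_mx Num.conj A^T.

Definition ket0 : 'cV[C]_2 := delta_mx 0 0.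
Definition ket1 : 'cV[C]_2 := delta_mx 1 0.

Definition pauliX : 'M[C]_2 := delta_mx 0 1 + delta_mx 1 0.
Definition pauliY : 'M[C]_2 := - 'i *: delta_mx 0 1 + 'i *: delta_mx 1 0.
Definition pauliZ : 'M[C]_2 := delta_mx 0 0 - delta_mx 1 1.

Definition tens_pow n (A : qop R n) (t : nat) : qop R (n * t) :=
  castmx (esym (expnM 2 n t), esym (expnM 2 n t)) (ntensmx A t).

Definition ket_zeros n : qvec R n :=
  castmx (erefl, exp1n n) (ntensmx ket0 n).

Lemma majorana_dim n (k : 'I_(2 * n)) :
  (2 ^ k./2 * 2 * 2 ^ (n - k./2.+1) = 2 ^ n)%N.
Proof.
rewrite -expnSr -expnD subnKC //.
by rewrite ltn_half_double -mul2n.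
Qed.

(* Zero-based indices: [majorana] at [k] is $c_{k+1}$, which acts by X (k even)
   or Y (k odd) on the qubit number [k./2], counting from 0. *)
Definition majorana n (k : 'I_(2 * n)) : qop R n :=
  castmx (majorana_dim k, majorana_dim k)
    (ntensmx pauliZ k./2 *t (if odd k then pauliY else pauliX) *t 1%:M).

Definition gaussian_unitary n : set (qop R n) :=
  [set U | U \is unitarymx /\
    exists2 O : 'M[R]_(2 * n), O *m O^T = 1%:M &
      forall j, U *m majorana j *m adjoint U
                = \sum_k (O j k)%:C *: majorana k].

Definition gaussian_state n : set (qvec R n) :=
  [set U *m ket_zeros n | U in gaussian_unitary (n:=n)].

Definition l1norm m (c : 'I_m -> C) : R :=
  \sum_j ComplexField.Normc.normc (c j).

(* The extent with respect to a dictionary [D].  For the two dictionaries used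
   below the infimum is a minimum, as the Gaussian unitaries form a compact set
   which spans the space of all operators. *)
Definition extent (E : lmodType C) (D : set E) (x : E) : R :=
  inf [set r | exists m (c : 'I_m -> C) (d : 'I_m -> E),
    [/\ forall j, D (d j), x = \sum_j c j *: d j & r = l1norm c ^+ 2]].

Definition unitary_extent n (U : qop R n) : R :=
  extent (gaussian_unitary (n:=n)) U.

Definition state_extent n (psi : qvec R n) : R :=
  extent (gaussian_state (n:=n)) psi.

Definition fermionic2 (V : qop R 2) : Prop := comm_mx V (pauliZ *t pauliZ).

Definition psi_plus : qvec R 2 :=
  (Num.sqrt 2)^-1%:C *: (ket0 *t ket0 + ket1 *t ket1).

Definition bell_pair_state : qvec R 4 := psi_plus *t psi_plus.

Definition act_middle (V : qop R 2) : qop R 4 :=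
  (1%:M : 'M[C]_2) *t V *t (1%:M : 'M[C]_2).

End Qubits.

(* Main.v *)
(* The lower bound on the extent comes from a dual witness. A fermionic V is a
   product G (a + b Z Z) with G Gaussian, so its extent is at most (|a| + |b|)^2;
   conversely, with a phase z aligning a and z b, the functional
   A |-> tr(((1 + z Z Z) G^+)^{(x) t} A) takes the value 4^t (|a| + |b|)^t at
   V^{(x) t}, and it is bounded by 4^t on Gaussian unitaries. For this last bound,
   let K be Gaussian with orthogonal matrix O. Then |tr K|^2 = det(1 + O), so
   Hadamard's inequality gives |tr K|^4 <= prod_i (2 + 2 O_ii), and AM-GM on each
   group b of four Majorana modes gives |tr K| <= prod_b w_b with
   w_b = (sum_{i in b} (1 + O_ii)) / 2. Multiplying K by Z Z on the block b flips
   the signs of the O_ii with i in b, and the two resulting values of w_b add up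
   to 4; hence expanding the t factors 1 + z Z Z one at a time yields 4^t. *)
Require Import Defs.
From mathcomp Require Import all_boot all_order all_algebra.
From mathcomp Require Import complex mxtens.
From mathcomp Require Import all_classical all_reals.
From mathcomp Require Import ring lra zify.

Set Implicit Arguments.
Unset Strict Implicit.
Unset Printing Implicit Defensive.

Import Order.TTheory GRing.Theory Num.Theory.

Local Open Scope ring_scope.
Local Open Scope complex_scope.

(** * Tensor products up to casts *)

(** Gaussian unitaries on [2t] qubits need not factor over the [t] pairs of qubits, so the bound on
    the witness cannot be multiplied up from [t = 1]. Hadamard and AM-GM replace the trace by a
    product of weights which depend on the diagonal of [O] only, and this product does factor.
    Nothing is lost at [K = 1]: a pair of qubits carries four modes, so the fourth root from AM-GM
    on a block matches the fourth power of the trace, and every weight is 4, the dimension of a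
    pair.

    The determinant formula is proved by elimination rather than by a normal form of [O]: a pivot on
    [1 + O] corresponds to multiplying [K] by two Clifford generators.

    The state extent enters through the Choi map from [V] to [|v>]. It is linear and injective and
    sends Gaussian unitaries to Gaussian states, so every decomposition of [V] gives one of [|v>]
    with the same coefficients, and the given decomposition of [|v>] comes from one of [V]. *)

Section PackedMatrices.
Variable F : comNzRingType.

(* Matrices packed with their dimensions: there the Kronecker product is strictly
   associative and unital, and casts disappear. *)
Definition pmx := {p : nat * nat & 'M[F]_(p.1, p.2)}.

Definition pk m n (A : 'M[F]_(m, n)) : pmx := existT _ (m, n) A.

Definition pt (a b : pmx) : pmx := pk (projT2 a *t projT2 b).

Lemma pk_inj m n : injective (@pk m n).
Proof.
(* Decidable equality of the dimensions turns a package back into a matrix; the default [A] is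
   reached on neither side. *)
move=> A B e; have := f_equal (fun a : pmx =>
  match (m =P (projT1 a).1), (n =P (projT1 a).2) with
  | ReflectT em, ReflectT en => castmx (esym em, esym en) (projT2 a)
  | _, _ => A end) e.
rewrite /=; case: eqP => // em; case: eqP => // en.
by rewrite !castmx_id.
Qed.

Lemma pk_cast m n m' n' (e : (m = m') * (n = n')) (A : 'M[F]_(m, n)) :
  pk (castmx e A) = pk A.
Proof. by case: e => e1 e2; case: m' / e1; case: n' / e2. Qed.

Lemma pk_tens m n p q (A : 'M[F]_(m, n)) (B : 'M[F]_(p, q)) :
  pk (A *t B) = pt (pk A) (pk B).
Proof. by []. Qed.

Lemma pk_eqP m n m' n' (A : 'M[F]_(m, n)) (B : 'M[F]_(m', n')) :
  m = m' -> n = n' ->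
  (forall (i : 'I_m) (j : 'I_n) (i' : 'I_m') (j' : 'I_n'), i = i' :> nat -> j = j' :> nat -> A i j = B i' j') ->
  pk A = pk B.
Proof.
move=> em en; case: m' / em B; case: n' / en => B AB.
by congr pk; apply/matrixP => i j; apply: AB.
Qed.

Lemma ptA : associative pt.
Proof.
move=> [[m n] A] [[p q] B] [[r s] D] /=; rewrite /pt /=.
apply: pk_eqP; rewrite ?mulnA // => i j i' j' ei ej.
case: (mxtens_indexP i) ei => i1 i23; case: (mxtens_indexP i23) => i2 i3.
case: (mxtens_indexP j) ej => j1 j23; case: (mxtens_indexP j23) => j2 j3.
case: (mxtens_indexP i') => i12' i3'; case: (mxtens_indexP i12') => i1' i2'.
case: (mxtens_indexP j') => j12' j3'; case: (mxtens_indexP j12') => j1' j2'.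
rewrite !tensmxE /= => ej ei; rewrite mulrA.
(* Both bracketings number the index triples by the same mixed-radix expansion, whose digits are
   unique. *)
have aux a b c x y z x' y' z' : (x < a)%N -> (x' < a)%N ->
  (y < b)%N -> (y' < b)%N -> (z < c)%N -> (z' < c)%N ->
  (x * (b * c) + (y * c + z) = (x' * b + y') * c + z')%N ->
  [/\ x = x', y = y' & z = z'].
  move=> _ _ hy hy' hz hz'; rewrite addnA mulnA -mulnDl => /eqP.
  rewrite eq_addl_mul // => /eqP[/eqP]; rewrite eq_addl_mul //.
  by move=> /eqP[-> ->] ->.
have [e1 e2 e3] := aux _ _ _ _ _ _ _ _ _ (ltn_ord i1) (ltn_ord i1')
  (ltn_ord i2) (ltn_ord i2') (ltn_ord i3) (ltn_ord i3') ei.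
have [f1 f2 f3] := aux _ _ _ _ _ _ _ _ _ (ltn_ord j1) (ltn_ord j1')
  (ltn_ord j2) (ltn_ord j2') (ltn_ord j3) (ltn_ord j3') ej.
by congr (A _ _ * B _ _ * D _ _); apply: val_inj.
Qed.

Lemma p1t (a : pmx) : pt (pk (1%:M : 'M_1)) a = a.
Proof. by case: a => [[m n] A]; rewrite /pt /= tens_scalar_mx pk_cast scale1r. Qed.

Lemma pt1 (a : pmx) : pt a (pk (1%:M : 'M_1)) = a.
Proof. by case: a => [[m n] A]; rewrite /pt /= tens_mx_scalar pk_cast scale1r. Qed.

Lemma tensmx11 m n : (1%:M : 'M[F]_m) *t (1%:M : 'M[F]_n) = 1%:M.
Proof.
apply/matrixP => i j.
case: (mxtens_indexP i) => i1 i2; case: (mxtens_indexP j) => j1 j2.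
by rewrite tensmxE !mxE -natrM mulnb (can_eq (@mxtens_indexK _ _)).
Qed.

Lemma pk_one_eq m n : m = n -> pk (1%:M : 'M[F]_m) = pk (1%:M : 'M[F]_n).
Proof. by move=> ->. Qed.

Lemma pt11 m n : pt (pk (1%:M : 'M_m)) (pk (1%:M : 'M_n)) = pk (1%:M : 'M_(m * n)).
Proof. by rewrite /pt /= tensmx11. Qed.

Lemma pk_ntens0 m n (A : 'M[F]_(m, n)) : pk (A ^t 0) = pk (1%:M : 'M_1).
Proof. by []. Qed.

Lemma pk_ntensS m n (A : 'M[F]_(m, n)) k : pk (A ^t k.+1) = pt (pk A) (pk (A ^t k)).
Proof. by case: k => [|k]; rewrite ?pk_ntens0 ?pt1. Qed.

Lemma pk_ntensD m n (A : 'M[F]_(m, n)) k l :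
  pk (A ^t (k + l)) = pt (pk (A ^t k)) (pk (A ^t l)).
Proof. by elim: k => [|k IH]; rewrite ?p1t // addSn !pk_ntensS IH ptA. Qed.

Lemma tensmxDl m n p q (A A' : 'M[F]_(m, n)) (B : 'M[F]_(p, q)) :
  (A + A') *t B = A *t B + A' *t B.
Proof. by apply/matrixP => i j; rewrite !mxE mulrDl. Qed.

Lemma tensmxDr m n p q (A : 'M[F]_(m, n)) (B B' : 'M[F]_(p, q)) :
  A *t (B + B') = A *t B + A *t B'.
Proof. by apply/matrixP => i j; rewrite !mxE mulrDr. Qed.

Lemma tensmxZl m n p q a (A : 'M[F]_(m, n)) (B : 'M[F]_(p, q)) :
  (a *: A) *t B = a *: (A *t B).
Proof. by apply/matrixP => i j; rewrite !mxE mulrA. Qed.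

Lemma tensmxZr m n p q a (A : 'M[F]_(m, n)) (B : 'M[F]_(p, q)) :
  A *t (a *: B) = a *: (A *t B).
Proof. by apply/matrixP => i j; rewrite !mxE mulrCA. Qed.

Lemma mxtrace_tens m n (A : 'M[F]_m) (B : 'M[F]_n) : \tr (A *t B) = \tr A * \tr B.
Proof.
by rewrite /mxtrace mulr_sum; apply: eq_bigr => i _; rewrite mxE.
Qed.

End PackedMatrices.

Section QubitTensor.
Variable R : realType.
Local Notation C := R[i].
Implicit Types m n : nat.

(** The Kronecker product typed as an operator on [m + n] qubits, so that it can be multiplied with
    other such operators. *)
Definition qt m n (A : qop R m) (B : qop R n) : qop R (m + n) :=
  castmx (esym (expnD 2 m n), esym (expnD 2 m n)) (A *t B).

Lemma pk_qt m n (A : qop R m) (B : qop R n) : pk (qt A B) = pt (pk A) (pk B).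
Proof. exact: pk_cast. Qed.

Lemma castmx_sq_mul p q (e : p = q) (A B : 'M[C]_p) :
  castmx (e, e) (A *m B) = castmx (e, e) A *m castmx (e, e) B.
Proof. by case: q / e. Qed.

Lemma castmx_lin p q (e : p = q) a (A B : 'M[C]_p) :
  castmx (e, e) (a *: A + B) = a *: castmx (e, e) A + castmx (e, e) B.
Proof. by case: q / e. Qed.

Lemma castmx_one p q (e : p = q) : castmx (e, e) (1%:M : 'M[C]_p) = 1%:M.
Proof. by case: q / e. Qed.

Lemma castmx_tr p q (e : p = q) (A : 'M[C]_p) : \tr (castmx (e, e) A) = \tr A.
Proof. by case: q / e. Qed.

Lemma castmx_adj p q (e : p = q) (A : 'M[C]_p) :
  adjoint (castmx (e, e) A) = castmx (e, e) (adjoint A).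
Proof. by case: q / e. Qed.

Lemma adjointK m n (A : 'M[C]_(m, n)) : adjoint (adjoint A) = A.
Proof. by apply/matrixP => i j; rewrite !mxE conjCK. Qed.

Lemma adjointZ m n a (A : 'M[C]_(m, n)) : adjoint (a *: A) = a^* *: adjoint A.
Proof. by apply/matrixP => i j; rewrite !mxE rmorphM. Qed.

Lemma adjoint_one n : adjoint (1%:M : 'M[C]_n) = 1%:M.
Proof. by rewrite /adjoint trmx1 map_mx1. Qed.

Lemma adjoint_tens m n p q (A : 'M[C]_(m, n)) (B : 'M[C]_(p, q)) :
  adjoint (A *t B) = adjoint A *t adjoint B.
Proof. by rewrite /adjoint trmx_tens map_mxT. Qed.

Lemma unitaryP n (U : 'M[C]_n) : reflect (U *m adjoint U = 1%:M) (U \is unitarymx).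
Proof. exact: unitarymxP. Qed.

Lemma unitary_adjl n (U : 'M[C]_n) : U \is unitarymx -> adjoint U *m U = 1%:M.
Proof. by move=> /unitaryP /mulmx1C. Qed.

Lemma qtM m n (A A' : qop R m) (B B' : qop R n) :
  qt A B *m qt A' B' = qt (A *m A') (B *m B').
Proof. by rewrite /qt -castmx_sq_mul tensmx_mul. Qed.

Lemma qt11 m n : qt (1%:M : qop R m) (1%:M : qop R n) = 1%:M.
Proof. by rewrite /qt tensmx11 castmx_one. Qed.

Lemma qt_linl m n a (A A' : qop R m) (B : qop R n) :
  qt (a *: A + A') B = a *: qt A B + qt A' B.
Proof. by rewrite /qt tensmxDl tensmxZl castmx_lin. Qed.

Lemma qt_linr m n a (A : qop R m) (B B' : qop R n) :
  qt A (a *: B + B') = a *: qt A B + qt A B'.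
Proof. by rewrite /qt tensmxDr tensmxZr castmx_lin. Qed.

Lemma adjoint_qt m n (A : qop R m) (B : qop R n) :
  adjoint (qt A B) = qt (adjoint A) (adjoint B).
Proof. by rewrite /qt castmx_adj adjoint_tens. Qed.

Lemma qt_unitary m n (A : qop R m) (B : qop R n) :
  A \is unitarymx -> B \is unitarymx -> qt A B \is unitarymx.
Proof.
move=> /unitaryP uA /unitaryP uB; apply/unitaryP.
by rewrite adjoint_qt qtM uA uB qt11.
Qed.

End QubitTensor.

(** * Majorana operators *)

Section Majorana.
Variable R : realType.
Local Notation C := R[i].

Definition parity n : qop R n := ntensmx (pauliZ R) n.

Definition lsh m n (i : 'I_(2 * m)) : 'I_(2 * (m + n)) :=
  cast_ord (esym (mulnDr 2 m n)) (lshift _ i).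
Definition rsh m n (i : 'I_(2 * n)) : 'I_(2 * (m + n)) :=
  cast_ord (esym (mulnDr 2 m n)) (rshift _ i).

Variant lrsh_spec m n (k : 'I_(2 * (m + n))) : Type :=
| LshSpec i of k = lsh n i
| RshSpec i of k = rsh m i.

Lemma lrshP m n (k : 'I_(2 * (m + n))) : lrsh_spec k.
Proof.
have -> : k = cast_ord (esym (mulnDr 2 m n)) (cast_ord (mulnDr 2 m n) k).
  exact: val_inj.
by case: (splitP (cast_ord (mulnDr 2 m n) k)) => i e;
  [apply: (@LshSpec _ _ _ i) | apply: (@RshSpec _ _ _ i)]; apply: val_inj.
Qed.

Lemma pk_majorana n (k : 'I_(2 * n)) :
  pk (majorana R k) = pt (pt (pk (ntensmx (pauliZ R) k./2))
     (pk (if odd k then pauliY R else pauliX R))) (pk (1%:M : qop R (n - k./2.+1))).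
Proof. by rewrite /majorana pk_cast !pk_tens. Qed.

Lemma majorana_lsh m n (i : 'I_(2 * m)) :
  majorana R (lsh n i) = qt (majorana R i) 1%:M.
Proof.
apply: pk_inj; rewrite pk_qt !pk_majorana /= -!ptA; congr pt; congr pt.
rewrite pt11; apply: pk_one_eq; rewrite -expnD; congr expn.
by have := ltn_ord i; lia.
Qed.

(** The Jordan-Wigner string of a mode in the second factor covers all qubits of the first, where it
    is the parity. *)
Lemma majorana_rsh m n (i : 'I_(2 * n)) :
  majorana R (rsh m i) = qt (parity m) (majorana R i).
Proof.
apply: pk_inj; rewrite pk_qt !pk_majorana /=.
have -> : ((2 * m + i)./2 = m + i./2)%N by lia.
have -> : odd (2 * m + i) = odd i by rewrite oddD oddM.
rewrite pk_ntensD !ptA; congr pt; apply: pk_one_eq; congr expn.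
by lia.
Qed.

Lemma parityD m n : parity (m + n) = qt (parity m) (parity n).
Proof. by apply: pk_inj; rewrite pk_qt pk_ntensD. Qed.

Lemma I2P (P : 'I_2 -> Prop) : P 0 -> P 1 -> forall i, P i.
Proof. by move=> P0 P1; case=> [[|[|//]]] h; [move: P0 | move: P1]; congr P; apply: val_inj. Qed.

Lemma matrix2P (A B : 'M[C]_2) :
  A 0 0 = B 0 0 -> A 0 1 = B 0 1 -> A 1 0 = B 1 0 -> A 1 1 = B 1 1 -> A = B.
Proof. by move=> *; apply/matrixP; elim/I2P; elim/I2P. Qed.

Definition sum2E := (big_ord_recl, big_ord0, addr0).

Lemma conj_i : Num.conj ('i : C) = - 'i.
Proof. by rewrite /= ; congr Complex; rewrite oppr0. Qed.
End Majorana.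

Section Pauli.
Variable R : realType.
Local Notation C := R[i].

Ltac pauli := apply: matrix2P;
  rewrite !(mxE, sum2E) /=; rewrite ?conj_i ?(rmorph0, rmorph1, rmorphN, rmorphD, rmorphM) /=;
  rewrite ?(mulr0, mul0r, mulr1, mul1r, addr0, add0r, subr0, sub0r, oppr0);
  rewrite ?conj_i ?(rmorph0, rmorph1) ?(mulrN, mulNr, opprK, mulr1, mulr0, addr0, oppr0) -?expr2 ?sqr_i ?opprK ?mul1r //.

Lemma pauliXX : pauliX R *m pauliX R = 1%:M. Proof. pauli. Qed.
Lemma pauliYY : pauliY R *m pauliY R = 1%:M. Proof. pauli. Qed.
Lemma pauliZZ : pauliZ R *m pauliZ R = 1%:M. Proof. pauli. Qed.
Lemma pauliXY : pauliX R *m pauliY R = - (pauliY R *m pauliX R). Proof. pauli. Qed.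
Lemma pauliZX : pauliZ R *m pauliX R = - (pauliX R *m pauliZ R). Proof. pauli. Qed.
Lemma pauliZY : pauliZ R *m pauliY R = - (pauliY R *m pauliZ R). Proof. pauli. Qed.
Lemma adjoint_pauliX : adjoint (pauliX R) = pauliX R. Proof. pauli. Qed.
Lemma adjoint_pauliY : adjoint (pauliY R) = pauliY R. Proof. pauli. Qed.
Lemma adjoint_pauliZ : adjoint (pauliZ R) = pauliZ R. Proof. pauli. Qed.

Lemma majorana1 (k : 'I_(2 * 1)) :
  majorana R k = if odd k then pauliY R else pauliX R.
Proof.
apply: pk_inj; rewrite pk_majorana.
have -> : k./2 = 0%N by have := ltn_ord k; lia.
by rewrite pk_ntens0 p1t pt1.
Qed.

(** The successor is written [1 + n] to match [lrshP], [majorana_lsh] and [parityD] when the first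
    qubit is split off. *)
Lemma qubit_ind (P : nat -> Prop) : P 0%N -> (forall n, P n -> P (1 + n)%N) -> forall n, P n.
Proof. by move=> P0 PS; elim. Qed.

Lemma adjoint_majorana n (k : 'I_(2 * n)) : adjoint (majorana R k) = majorana R k.
Proof.
elim/qubit_ind: n k => [|n IH] k; first by case: k.
case: (@lrshP 1 n k) => i ->.
  rewrite majorana_lsh adjoint_qt adjoint_one majorana1.
  by case: ifP; rewrite ?adjoint_pauliX ?adjoint_pauliY.
by rewrite majorana_rsh adjoint_qt IH adjoint_pauliZ.
Qed.

Lemma adjoint_parity n : adjoint (parity R n) = parity R n.
Proof.
elim/qubit_ind: n => [|n IH]; first exact: adjoint_one.
by rewrite (parityD R 1 n) adjoint_qt IH adjoint_pauliZ.
Qed.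

Lemma parityM n : parity R n *m parity R n = 1%:M.
Proof.
elim/qubit_ind: n => [|n IH]; first by rewrite mulmx1.
by rewrite (parityD R 1 n) qtM IH (pauliZZ) (qt11 R 1).
Qed.

Lemma parity_unitary n : parity R n \is unitarymx.
Proof. by apply/unitaryP; rewrite adjoint_parity parityM. Qed.

Lemma qt0l m n (B : qop R n) : qt (0 : qop R m) B = 0.
Proof. by apply/matrixP => i j; rewrite castmxE tens0mx !mxE. Qed.

Lemma qt0r m n (A : qop R m) : qt A (0 : qop R n) = 0.
Proof. by apply/matrixP => i j; rewrite castmxE tensmx0 !mxE. Qed.

Lemma qtZl m n a (A : qop R m) (B : qop R n) : qt (a *: A) B = a *: qt A B.
Proof. by rewrite -[a *: A]addr0 qt_linl qt0l addr0. Qed.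

Lemma qtZr m n a (A : qop R m) (B : qop R n) : qt A (a *: B) = a *: qt A B.
Proof. by rewrite -[a *: B]addr0 qt_linr qt0r addr0. Qed.

Lemma qtDl m n (A A' : qop R m) (B : qop R n) : qt (A + A') B = qt A B + qt A' B.
Proof. by rewrite -{1}[A]scale1r qt_linl scale1r. Qed.

Lemma qtDr m n (A : qop R m) (B B' : qop R n) : qt A (B + B') = qt A B + qt A B'.
Proof. by rewrite -{1}[B]scale1r qt_linr scale1r. Qed.

Lemma qtNl m n (A : qop R m) (B : qop R n) : qt (- A) B = - qt A B.
Proof. by rewrite -scaleN1r qtZl scaleN1r. Qed.

Lemma qtNr m n (A : qop R m) (B : qop R n) : qt A (- B) = - qt A B.
Proof. by rewrite -scaleN1r qtZr scaleN1r. Qed.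

Lemma parity_majorana n (k : 'I_(2 * n)) :
  parity R n *m majorana R k = - (majorana R k *m parity R n).
Proof.
elim/qubit_ind: n k => [|n IH] k; first by case: k.
rewrite (parityD R 1 n); case: (@lrshP 1 n k) => i ->.
  rewrite majorana_lsh !qtM mulmx1 mul1mx majorana1 -qtNl.
  by congr qt; case: ifP; rewrite ?pauliZX ?pauliZY.
by rewrite majorana_rsh !qtM IH qtNr.
Qed.

(** The canonical anticommutation relations. For modes in different factors the sign comes from the
    string, since parity anticommutes with every mode. *)
Lemma majoranaM n (i j : 'I_(2 * n)) :
  majorana R i *m majorana R j + majorana R j *m majorana R i
  = ((i == j)%:R *+ 2)%:M.
Proof.
elim/qubit_ind: n i j => [|n IH] i j; first by case: i.
case: (@lrshP 1 n i) => i' ->; case: (@lrshP 1 n j) => j' ->;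
  rewrite ?majorana_lsh ?majorana_rsh !qtM ?mulmx1 ?mul1mx.
- rewrite (inj_eq (@cast_ord_inj _ _ _)) (inj_eq (@lshift_inj _ _)) !majorana1.
  have -> : (i' == j') = (odd i' == odd j').
    rewrite -val_eqE /=; have := ltn_ord i'; have := ltn_ord j'.
    by case: (val i') => [|[|//]]; case: (val j') => [|[|//]].
  case: (odd i'); case: (odd j'); rewrite ?pauliXX ?pauliYY ?pauliXY ?qtNl.
  + by rewrite (qt11 R 1) -mulr2n -[1%:M *+ 2]scaler_nat scalemx1.
  + by rewrite subrr mul0rn raddf0.
  + by rewrite addNr mul0rn raddf0.
  + by rewrite (qt11 R 1) -mulr2n -[1%:M *+ 2]scaler_nat scalemx1.
- rewrite parity_majorana qtNl subrr.
  rewrite (inj_eq (@cast_ord_inj _ _ _)) -val_eqE /= ltn_eqF ?mul0rn ?raddf0 //.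
  by have := ltn_ord i'; lia.
- rewrite parity_majorana qtNl addNr.
  rewrite (inj_eq (@cast_ord_inj _ _ _)) -val_eqE /= gtn_eqF ?mul0rn ?raddf0 //.
  by have := ltn_ord j'; lia.
rewrite parityM (inj_eq (@cast_ord_inj _ _ _)) (inj_eq (@rshift_inj _ _)).
rewrite -qtDr IH.
by rewrite -[in LHS](@scalemx1 _ _ (_ *+ 2)) qtZr (qt11 R 1) scalemx1.
Qed.

End Pauli.

(** * Irreducibility of the Majorana operators *)

Section Irreducible.
Variable R : realType.
Local Notation C := R[i].

(** Fixing the indices [i], [j] of the second factor cuts [A] into 2 x 2 matrices, and [S *t 1%:M]
    acts on each of them separately. *)
Lemma tens1_mulE p (S : 'M[C]_2) (A : 'M[C]_(2 * p)) (i j : 'I_p) :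
  let M (B : 'M[C]_(2 * p)) : 'M[C]_2 :=
    \matrix_(a, b) B (mxtens_index (a, i)) (mxtens_index (b, j)) in
  M ((S *t 1%:M) *m A) = S *m M A /\ M (A *m (S *t 1%:M)) = M A *m S.
Proof.
move=> M; pose h (x : 'I_2 * 'I_p) := mxtens_index x.
have reindx (F : 'I_(2 * p) -> C) : \sum_k F k = \sum_a \sum_b F (mxtens_index (a, b)).
  rewrite pair_big (reindex h) /=; first by apply: eq_bigr => -[a b] _.
  by exists (@mxtens_unindex 2 p) => k _; rewrite /h ?mxtens_indexK ?mxtens_unindexK.
split; apply/matrixP => a b; rewrite !mxE reindx; apply: eq_bigr => c _.
  rewrite (bigD1 i) //= big1 => [|k ki]; rewrite tensmxE !mxE.
    by rewrite eqxx mulr1 addr0.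
  by rewrite eq_sym (negPf ki) mulr0 mul0r.
rewrite (bigD1 j) //= big1 => [|k kj]; rewrite tensmxE !mxE.
  by rewrite eqxx mulr1 addr0.
by rewrite (negPf kj) !mulr0.
Qed.

Lemma comm_pauli (M : 'M[C]_2) :
  pauliX R *m M = M *m pauliX R -> pauliY R *m M = M *m pauliY R ->
  M = (M 0 0)%:M.
Proof.
move=> /matrixP eX /matrixP eY.
have := eX 0 0; have := eX 0 1; have := eY 0 0.
rewrite !(mxE, sum2E) /= !(mulr0, mul0r, mulr1, mul1r, addr0, add0r).
have -> : lift ord0 ord0 = 1 :> 'I_2 by apply: val_inj.
have -> : ord0 = 0 :> 'I_2 by apply: val_inj.
move=> y00 x01 x00.
have i0 : ('i : C) != 0 by rewrite eq_complex /= oner_eq0 andbF.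
(* Commuting with X makes the off-diagonal entries equal, commuting with Y makes them opposite. *)
have m01 : M 0 1 = 0.
  apply/eqP; have : M 0 1 *+ 2 * 'i == 0.
    by rewrite mulr2n mulrDl addr_eq0 -{1}y00 x00 mulNr mulrC.
  by rewrite mulf_eq0 (negPf i0) orbF mulrn_eq0.
apply: matrix2P; rewrite !mxE /= ?mulr1n ?mulr0n ?x00 ?m01 ?x01 //.
Qed.

Lemma comm_pauli_tens p (A : 'M[C]_(2 * p)) :
  (pauliX R *t 1%:M) *m A = A *m (pauliX R *t 1%:M) ->
  (pauliY R *t 1%:M) *m A = A *m (pauliY R *t 1%:M) ->
  exists B : 'M[C]_p, A = 1%:M *t B.
Proof.
move=> eX eY.
exists (\matrix_(i, j) A (mxtens_index (0, i)) (mxtens_index (0, j))).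
apply/matrixP => k l; case: (mxtens_indexP k) => a i; case: (mxtens_indexP l) => b j.
have [lX rX] := tens1_mulE (pauliX R) A i j.
have [lY rY] := tens1_mulE (pauliY R) A i j.
pose M : 'M[C]_2 := \matrix_(a, b) A (mxtens_index (a, i)) (mxtens_index (b, j)).
have cX : pauliX R *m M = M *m pauliX R by rewrite -[LHS]lX eX [LHS]rX.
have cY : pauliY R *m M = M *m pauliY R by rewrite -[LHS]lY eY [LHS]rY.
have /matrixP /(_ a b) := comm_pauli cX cY.
by rewrite tensmxE !mxE mulr_natl.
Qed.

Lemma qt_inj_r n (A B : qop R n) m (D : qop R m) : D != 0 -> qt D A = qt D B -> A = B.
Proof.
move=> D0 /(congr1 (@pk _ _ _)); rewrite !pk_qt -!pk_tens => /pk_inj /matrixP AB.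
have [i [j Dij]] : exists i, exists j, D i j != 0.
  apply: contrapT => H; move/eqP: D0; apply; apply/matrixP => i j; rewrite mxE.
  by apply: contrapT => /eqP Dij; apply: H; exists i, j.
apply/matrixP => k l; have := AB (mxtens_index (i, k)) (mxtens_index (j, l)).
by rewrite !tensmxE => /(mulfI Dij).
Qed.

(** A Schur lemma, one qubit at a time: the two modes of the first qubit force [A] to be [1] tensor
    [B]. The other modes are Z tensor a mode, and cancelling Z shows that [B] commutes with all
    modes of the remaining qubits. *)
Lemma majorana_irreducible n (A : qop R n) :
  (forall k, majorana R k *m A = A *m majorana R k) -> exists a, A = a%:M.
Proof.
elim/qubit_ind: n A => [|n IH] A cA; first by exists (A 0 0); exact: mx11_scalar.
have [B AB] : exists B : qop R n, A = qt (1%:M : qop R 1) B.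
  have qA : A = castmx (esym (expnD 2 1 n), esym (expnD 2 1 n)) (castmx (expnD 2 1 n, expnD 2 1 n) A).
    by rewrite castmxK.
  have [k0 k1] : (exists k : 'I_(2 * 1), odd k = false) /\ (exists k : 'I_(2 * 1), odd k = true).
    by split; [exists (inord 0) | exists (inord 1)]; rewrite inordK.
  have [||B AB] := @comm_pauli_tens (2 ^ n) (castmx (expnD 2 1 n, expnD 2 1 n) A); last first.
  - by exists B; rewrite /qt -AB castmxK.
  - case: k1 => k ok; have := cA (lsh n k); rewrite majorana_lsh majorana1 ok /qt.
    move=> /(congr1 (castmx (expnD 2 1 n, expnD 2 1 n))).
    by rewrite !castmx_sq_mul !castmxKV.
  case: k0 => k ok; have := cA (lsh n k); rewrite majorana_lsh majorana1 ok /qt.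
  move=> /(congr1 (castmx (expnD 2 1 n, expnD 2 1 n))).
  by rewrite !castmx_sq_mul !castmxKV.
have [k|a Ba] := IH B.
  apply: (@qt_inj_r _ _ _ 1 (parity R 1)).
    apply/eqP => z0; have := parityM R 1; rewrite z0 mul0mx => /matrixP/(_ 0 0).
    by rewrite !mxE /= => /eqP; rewrite eq_sym oner_eq0.
  by have := cA (rsh 1 k); rewrite majorana_rsh AB !qtM mul1mx mulmx1.
by exists a; rewrite AB Ba -[in LHS](@scalemx1 _ _ a) qtZr (qt11 R 1) scalemx1.
Qed.

End Irreducible.

(** * The trace of a Gaussian unitary *)

(** Each determinant is the entry at [(i, i)] times the determinant of one common Schur
    complement. *)
Lemma det_pivot (F : fieldType) n (A B : 'M[F]_n) (i : 'I_n) :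
  A i i != 0 -> (forall j, j != i -> B j i = 0) ->
  (forall j k, j != i -> k != i -> B j k = A j k - A j i * A i k / A i i) ->
  A i i * \det B = B i i * \det A.
Proof.
move=> Aii Bi Bjk.
(* [D] is [A] with column [i] cleared off the diagonal, and [L] undoes the row operations. *)
pose L : 'M[F]_n := \matrix_(j, k) ((j == k)%:R + (if (j != i) && (k == i) then A j i / A i i else 0)).
pose D : 'M[F]_n := \matrix_(j, k) (if j == i then A i k else A j k - A j i * A i k / A i i).
have detL : \det L = 1.
  rewrite (expand_det_row _ i) (bigD1 i) //= big1 => [|k ki]; last first.
    by rewrite mxE eq_sym (negPf ki) eqxx addr0 mul0r.
  rewrite mxE eqxx /= !addr0 mul1r /cofactor -signr_odd oddD addbb mul1r.
  rewrite -[RHS](det1 F n.-1); congr (\det _); apply/matrixP => j k.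
  rewrite !mxE (inj_eq (@lift_inj _ _)) [lift i k == i]eq_sym (negPf (neq_lift i k)).
  by rewrite andbF addr0.
have A_LD : A = L *m D.
  apply/matrixP => j k; rewrite mxE (bigD1 i) //=.
  have [->|ji] := eqVneq j i.
    rewrite !mxE !eqxx addr0 mul1r big1 ?addr0 // => l li.
    by rewrite !mxE eq_sym (negPf li) eqxx addr0 mul0r.
  rewrite (bigD1 j) //= big1 => [|l /andP[li lj]]; last first.
    by rewrite !mxE eq_sym (negPf lj) (negPf li) andbF addr0 mul0r.
  rewrite !mxE !eqxx ji (negPf ji) /= add0r !addr0 mul1r.
  by rewrite [X in X + _]mulrAC addrC subrK.
have detE (M : 'M[F]_n) : (forall j, j != i -> M j i = 0) -> \det M = M i i * cofactor M i i.
  move=> Mi; rewrite (expand_det_col _ i) (bigD1 i) //= big1 ?addr0 // => j ji.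
  by rewrite Mi // mul0r.
have Di j : j != i -> D j i = 0.
  by move=> ji; rewrite mxE (negPf ji) mulfK // subrr.
rewrite A_LD det_mulmx detL mul1r (detE B) // (detE D) // -A_LD.
rewrite {2}/D mxE eqxx mulrCA; congr (_ * (_ * _)).
rewrite /cofactor; congr (_ * \det _); apply/matrixP => j k; rewrite !mxE.
rewrite [lift i j == i]eq_sym (negPf (neq_lift i j)).
by rewrite Bjk // eq_sym neq_lift.
Qed.

(** * Clifford generators and their reflections *)

Section Clifford.
Variables (R : realType) (n : nat).
Local Notation C := R[i].
Implicit Types (u v w : 'rV[R]_(2 * n)) (U : qop R n) (O : 'M[R]_(2 * n)).

Definition gam v : qop R n := \sum_k (v 0 k)%:C *: majorana R k.

Definition dot u v : R := \sum_k u 0 k * v 0 k.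

Lemma gamP a u v : gam (a *: u + v) = a%:C *: gam u + gam v.
Proof.
rewrite /gam scaler_sumr -big_split; apply: eq_bigr => k _ /=.
by rewrite !mxE rmorphD rmorphM scalerDl scalerA.
Qed.

Lemma gamN v : gam (- v) = - gam v.
Proof.
by rewrite /gam -sumrN; apply: eq_bigr => k _; rewrite mxE rmorphN scaleNr.
Qed.

Lemma gam_delta k : gam (delta_mx 0 k) = majorana R k.
Proof.
rewrite /gam (bigD1 k) //= big1 => [|l lk]; rewrite !mxE eqxx /=.
  by rewrite eqxx addr0 scale1r.
by rewrite (negPf lk) scale0r.
Qed.

Lemma gamM u v : gam u *m gam v + gam v *m gam u = (dot u v *+ 2)%:C%:M.
Proof.
have gamMs a b : gam a *m gam b =
  \sum_k \sum_l (a 0 k * b 0 l)%:C *: (majorana R k *m majorana R l).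
  rewrite /gam mulmx_suml; apply: eq_bigr => k _; rewrite mulmx_sumr.
  by apply: eq_bigr => l _; rewrite -scalemxAl -scalemxAr scalerA rmorphM.
rewrite !gamMs [X in _ + X]exchange_big -big_split /=.
transitivity (\sum_k \sum_l ((u 0 k * v 0 l)%:C *: (((k == l)%:R *+ 2)%:M : qop R n))).
  apply: eq_bigr => k _; rewrite -big_split; apply: eq_bigr => l _ /=.
  by rewrite [v 0 l * _]mulrC -scalerDr majoranaM.
rewrite /dot -sumrMnl !raddf_sum; apply: eq_bigr => k _.
rewrite (bigD1 k) //= big1 => [|l lk].
  by rewrite eqxx addr0 scale_scalar_mx mulrnAr mulr1 -rmorphMn.
by rewrite eq_sym (negPf lk) mul0rn raddf0 scaler0.
Qed.

Lemma adjoint_gam v : adjoint (gam v) = gam v.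
Proof.
rewrite /adjoint /gam !raddf_sum; apply: eq_bigr => k _ /=.
rewrite -[in RHS](adjoint_majorana R k) -[in RHS](conjc_real (v 0 k)).
exact: adjointZ.
Qed.

Lemma scalar_mx_inj (a b : C) : a%:M = b%:M :> qop R n -> a = b.
Proof.
have p : (0 < 2 ^ n)%N by rewrite expn_gt0.
by move=> /matrixP/(_ (Ordinal p) (Ordinal p)); rewrite !mxE eqxx.
Qed.

Lemma gamMM w : dot w w = 1 -> gam w *m gam w = 1%:M.
Proof.
move=> ww; have := gamM w w; rewrite ww -mulr2n -scaler_nat => e.
by rewrite -[LHS](@scalerK _ _ 2) ?pnatr_eq0 // e scale_scalar_mx rmorphMn mulVf // pnatr_eq0.
Qed.

(** Conjugation by a unit vector fixes [w] and negates its orthogonal complement: it is minus the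
    reflection in the hyperplane orthogonal to [w]. *)
Lemma gam_refl w x : dot w w = 1 ->
  gam w *m gam x *m gam w = gam ((dot w x *+ 2) *: w - x).
Proof.
move=> ww.
have -> : gam w *m gam x = (dot w x *+ 2)%:C%:M - gam x *m gam w.
  by rewrite -gamM addrK.
by rewrite mulmxBl -mulmxA gamMM // mulmx1 mul_scalar_mx gamP gamN.
Qed.

Lemma dot_delta k v : dot (delta_mx 0 k) v = v 0 k.
Proof.
rewrite /dot (bigD1 k) //= big1 => [|l lk]; rewrite !mxE eqxx /=.
  by rewrite eqxx addr0 mul1r.
by rewrite (negPf lk) mul0r.
Qed.

(** The relation defining a Gaussian unitary, with the adjoint moved to the other side; for unitary
    [U] it forces [O] to be orthogonal. *)
Definition implements U O := forall j, U *m majorana R j = gam (row j O) *m U.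

Lemma dot_row O j k : dot (row j O) (row k O) = (O *m O^T) j k.
Proof. by rewrite mxE; apply: eq_bigr => l _; rewrite !mxE. Qed.

(** Conjugation by [U] preserves anticommutators, and those of the images are twice the Gram matrix
    of the rows of [O]. *)
Lemma implements_orth U O : U \is unitarymx -> implements U O -> O *m O^T = 1%:M.
Proof.
move=> uU UO; apply/matrixP => j k; rewrite -dot_row mxE.
have := gamM (row j O) (row k O).
have E l : gam (row l O) = U *m majorana R l *m adjoint U.
  by rewrite UO -mulmxA (unitaryP _ uU) mulmx1.
rewrite !E.
have -> : U *m majorana R j *m adjoint U *m (U *m majorana R k *m adjoint U)
  + U *m majorana R k *m adjoint U *m (U *m majorana R j *m adjoint U)
  = U *m (majorana R j *m majorana R k + majorana R k *m majorana R j) *m adjoint U.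
  rewrite mulmxDr mulmxDl; congr (_ + _); rewrite !mulmxA;
  by rewrite -[_ *m adjoint U *m U]mulmxA unitary_adjl // mulmx1.
rewrite majoranaM scalar_mxC -mulmxA (unitaryP _ uU) mulmx1 => /scalar_mx_inj.
rewrite -(rmorph_nat (real_complex R)) -rmorphMn => /complexI /eqP.
by rewrite -subr_eq0 -mulrnBl mulrn_eq0 /= subr_eq0 => /eqP.
Qed.

End Clifford.

(** Used with [a = 1 + O_ii], with [s] the length of [e_i] plus row [i] of [O], and with [x], [y]
    the traces before and after a pivot. *)
Lemma norm_pivot (R : realType) (s a : R) (x y : R[i]) :
  s%:C * y = x *+ 2 -> s * s = a *+ 2 -> `|x| ^+ 2 = (a / 2)%:C * `|y| ^+ 2.
Proof.
move=> sy ss.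
have -> : x = (s / 2)%:C * y.
  by rewrite rmorphM mulrAC sy fmorphV rmorph_nat -[x *+ 2]mulr_natr mulfK ?pnatr_eq0.
have nr : `|(s / 2)%:C| ^+ 2 = (a / 2)%:C :> R[i].
  rewrite -add_Re2_Im2 /= expr0n addr0; congr _%:C.
  by rewrite exprMn expr2 ss; field.
by rewrite normrM exprMn nr.
Qed.

Section Trace.
Variables (R : realType) (n : nat).
Local Notation C := R[i].
Implicit Types (u v w : 'rV[R]_(2 * n)) (U : qop R n) (O : 'M[R]_(2 * n)).

Lemma majorana_sqr (k : 'I_(2 * n)) : majorana R k *m majorana R k = 1%:M.
Proof.
by rewrite -!gam_delta gamMM // dot_delta mxE !eqxx.
Qed.

Lemma majorana_unitary (k : 'I_(2 * n)) : majorana R k \is unitarymx.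
Proof. by apply/unitaryP; rewrite adjoint_majorana majorana_sqr. Qed.

Lemma gam_unitary w : dot w w = 1 -> gam w \is unitarymx.
Proof. by move=> ww; apply/unitaryP; rewrite adjoint_gam gamMM. Qed.

Lemma dotC u v : dot u v = dot v u.
Proof. by apply: eq_bigr => k _; rewrite mulrC. Qed.

Lemma dotP a u v w : dot (a *: u + v) w = a * dot u w + dot v w.
Proof.
rewrite /dot mulr_sumr -big_split; apply: eq_bigr => k _ /=.
by rewrite !mxE mulrDl mulrA.
Qed.

Lemma dotZ a u w : dot (a *: u) w = a * dot u w.
Proof. by rewrite /dot mulr_sumr; apply: eq_bigr => k _ /=; rewrite !mxE mulrA. Qed.

Lemma dotD u v w : dot (u + v) w = dot u w + dot v w.
Proof. by have := dotP 1 u v w; rewrite scale1r mul1r. Qed.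

(* One step of Gaussian elimination on [1 + O] with pivot [i]: a product of two
   reflections turns [U] into a Gaussian unitary commuting with mode [i]. *)
Lemma implements_pivot U O i : U \is unitarymx -> implements U O ->
  1 + O i i != 0 ->
  exists U' O', [/\ U' \is unitarymx, implements U' O',
    `|(\tr U : C)| ^+ 2 = ((1 + O i i) / 2)%:C * `|(\tr U' : C)| ^+ 2,
    forall j, O' j i = (j == i)%:R &
    forall j k, k != i ->
      O' j k = O j k - ((j == i)%:R + O j i) * O i k / (1 + O i i)].
Proof.
move=> uU UO Oii0.
have OO := implements_orth uU UO.
have rr j k : dot (row j O) (row k O) = (j == k)%:R by rewrite dot_row OO mxE.
(* The half-turn about this bisector takes row [i] of [O] to [e_i]; the nonzero pivot keeps [v] from
   vanishing. *)
pose v : 'rV[R]_(2 * n) := delta_mx 0 i + row i O.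
have vv : dot v v = (1 + O i i) *+ 2.
  rewrite /v dotD !(dotC _ (_ + _)) !dotD rr !dot_delta (dotC (row i O)).
  rewrite dot_delta !mxE !eqxx /=; ring.
have vv0 : 0 < dot v v.
  rewrite lt_def vv mulrn_eq0 (negPf Oii0) /= -vv.
  by apply: sumr_ge0 => k _; rewrite -expr2 sqr_ge0.
pose s : R := Num.sqrt (dot v v).
have s0 : s != 0 by rewrite sqrtr_eq0 -ltNge.
have ss : s * s = dot v v by rewrite -expr2 sqr_sqrtr // ltW.
pose w := s^-1 *: v.
have ww : dot w w = 1 by rewrite dotZ dotC dotZ -ss; field.
pose c := majorana R i.
pose O' : 'M[R]_(2 * n) := \matrix_(j, k) (if k == i then (j == i)%:R else
   O j k - ((j == i)%:R + O j i) * O i k / (1 + O i i)).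
pose y j := (dot w (row j O) *+ 2) *: w - row j O.
have dwr j : dot w (row j O) = s^-1 * ((j == i)%:R + O j i).
  by rewrite dotZ dotD dot_delta rr mxE addrC eq_sym.
have s2 : s^-1 * s^-1 = (1 + O i i)^-1 / 2.
  by rewrite -invfM ss vv -mulr_natr invfM.
have alg (z t r a : R) : a != 0 -> z * z = a^-1 / 2 ->
    z * t *+ 2 * (z * r) = t * r / a.
  by move=> a0 zz; transitivity (z * z * (t * r * 2)); [ring | rewrite zz; field].
have yE j k : y j 0 k =
    ((j == i)%:R + O j i) * ((k == i)%:R + O i k) / (1 + O i i) - O j k.
  rewrite !mxE dwr eqxx /=; congr (_ - _).
  set t := _ + O j i; set r := _ + O i k.
  by apply: alg.
have T1 : true%:R = 1 :> R by []. have F0 : false%:R = 0 :> R by [].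
have rO' j : row j O' = (dot (delta_mx 0 i) (y j) *+ 2) *: delta_mx 0 i - y j.
  apply/rowP => k; rewrite dot_delta [RHS]mxE [X in X + _]mxE [X in _ + X]mxE !yE !mxE !eqxx /=.
  have [->|ki] := eqVneq k i; rewrite ?T1 ?F0; last by ring.
  by field.
exists (c *m gam w *m U), O'; split.
- by rewrite !mul_unitarymx ?majorana_unitary ?gam_unitary.
- move=> j; rewrite rO' -gam_refl; last by rewrite dot_delta mxE !eqxx.
  rewrite /y -gam_refl // gam_delta -/c -[in LHS]mulmxA UO !mulmxA.
  rewrite -[_ *m c *m c]mulmxA majorana_sqr mulmx1.
  by rewrite -[_ *m gam w *m gam w]mulmxA gamMM // mulmx1.
(* [s *: w = v], and [gam v] is [c] plus [gam (row i O)]. Since [gam (row i O) *m U = U *m c],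
   cyclicity makes both terms equal to the trace of [U]. *)
- have tr2 : s%:C * \tr (c *m gam w *m U) = \tr U *+ 2.
    rewrite -mxtraceZ scalemxAl scalemxAr.
    have -> : s%:C *: gam w = gam v.
      have := gamP s w 0; rewrite /gam [X in _ = _ + X]big1 ?addr0 => [<-|k _].
        by rewrite /w scalerA mulfV // scale1r.
      by rewrite mxE scale0r.
    have := gamP 1 (delta_mx 0 i) (row i O); rewrite !scale1r -/v gam_delta => ->.
    rewrite mulmxDr mulmxDl majorana_sqr mul1mx -mulmxA -UO mulmxA mxtraceD.
    by rewrite mxtrace_mulC mulmxA majorana_sqr mul1mx mulr2n.
  exact: norm_pivot tr2 (etrans ss vv).
- by move=> j; rewrite mxE eqxx.
- by move=> j k ki; rewrite mxE (negPf ki).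
Qed.

End Trace.

Section TraceFormula.
Variables (R : realType) (n : nat).
Local Notation C := R[i].
Implicit Types (U : qop R n) (O : 'M[R]_(2 * n)).

Lemma dot_self_eq0 (v : 'rV[R]_(2 * n)) : dot v v = 0 -> v = 0.
Proof.
move=> /eqP; rewrite psumr_eq0 => [/allP v0|k _]; last by rewrite -expr2 sqr_ge0.
apply/rowP => k; have /implyP/(_ isT) := v0 k (mem_index_enum k).
by rewrite mulf_eq0 orbb mxE => /eqP.
Qed.

(** Pivots run from the last mode down, the rows from [m] on being those of the identity. At the end
    [U] is a phase by irreducibility, and both sides are [4^n]. *)
Lemma gaussian_trace U O : U \is unitarymx -> implements U O ->
  `|(\tr U : C)| ^+ 2 = (\det (1%:M + O))%:C.
Proof.
suff H m : (m <= 2 * n)%N -> forall U O, U \is unitarymx -> implements U O ->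
    (forall j : 'I_(2 * n), (m <= j)%N -> row j O = delta_mx 0 j) ->
    `|(\tr U : C)| ^+ 2 = (\det (1%:M + O))%:C.
  by move=> uU UO; apply: (H (2 * n)%N) => // j; rewrite leqNgt ltn_ord.
elim: m => [|m IH] le_m {}U {}O uU UO fixO.
  have O1 : O = 1%:M by apply/row_matrixP => j; rewrite fixO // row1.
  have [k|a Ua] := @majorana_irreducible R n U.
    by rewrite UO O1 row1 gam_delta.
  have a1 : `|a| ^+ 2 = 1.
    move/unitaryP: uU; rewrite Ua /adjoint tr_scalar_mx map_scalar_mx -scalar_mxM.
    by move/scalar_mx_inj; rewrite normCK.
  rewrite Ua mxtrace_scalar -mulr_natr normrM exprMn a1 mul1r normr_nat -natrX O1.
  by rewrite -raddfD det_scalar /= -[1 + 1]/(2%:R) -natrX rmorph_nat -expnM mulnC.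
pose i : 'I_(2 * n) := Ordinal le_m.
have OO := implements_orth uU UO.
(* A vanishing pivot means that row [i] of [O] is [-e_i]. Then [1 + O] has a zero row and [U]
   anticommutes with mode [i], so both sides vanish. *)
have [Oi|Oi] := eqVneq (1 + O i i) 0.
  have rowi : row i O = - delta_mx 0 i.
    apply/eqP; rewrite -subr_eq0 opprK addrC; apply/eqP/dot_self_eq0.
    rewrite dotD !(dotC _ (_ + _)) !dotD dot_row OO !dot_delta (dotC (row i O)).
    rewrite dot_delta !mxE !eqxx /=.
    have T1 : true%:R = 1 :> R by [].
    by rewrite ?T1; move: Oi; lra.
  have -> : \det (1%:M + O) = 0.
    rewrite (expand_det_row _ i) big1 // => k _; rewrite !mxE.
    move/rowP/(_ k): rowi; rewrite !mxE eqxx /= => ->.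
    by rewrite eq_sym subrr mul0r.
  have trU : \tr U = - \tr U.
    rewrite -{1}[U]mul1mx -(majorana_sqr R i) -mulmxA mxtrace_mulC -mulmxA UO.
    by rewrite rowi gamN gam_delta mulNmx mulmxN mulmxA majorana_sqr mul1mx raddfN.
  have -> : \tr U = 0.
    by apply/eqP; rewrite -[_ == 0](mulrn_eq0 (\tr U) 2) mulr2n {1}trU addNr.
  by rewrite normr0 expr0n.
have [U' [O' [uU' UO' -> O'i O'jk]]] := implements_pivot uU UO Oi.
rewrite (IH (ltnW le_m) U' O' uU' UO') => [|j mj].
  rewrite -rmorphM; congr _%:C.
  have Ai : (1%:M + O) i i = 1 + O i i by rewrite !mxE eqxx.
  have Bi j : j != i -> (1%:M + O') j i = 0.
    by move=> ji; rewrite !mxE O'i (negPf ji) addr0.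
  have Bjk j k : j != i -> k != i -> (1%:M + O') j k =
      (1%:M + O) j k - (1%:M + O) j i * (1%:M + O) i k / (1%:M + O) i i.
    move=> ji ki; rewrite Ai !mxE O'jk // (negPf ji) [i == k]eq_sym (negPf ki) !add0r.
    by rewrite addrA.
  have Ai0 : (1%:M + O) i i != 0 by rewrite Ai.
  have := det_pivot Ai0 Bi Bjk; rewrite Ai.
  have -> : (1%:M + O') i i = 2 by rewrite !mxE O'i eqxx.
  move=> e; apply: (mulfI (x := 2)); first by rewrite pnatr_eq0.
  by rewrite -e; field.
(* Row [i] becomes [e_i]; a row fixed earlier has entry 0 in column [i] and does not change. *)
apply/rowP => k; rewrite !mxE eqxx /=.
have [->|ki] := eqVneq k i; first by rewrite O'i eq_sym.
rewrite O'jk //; move: mj; rewrite leq_eqVlt => /orP[/eqP mj|mj].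
  have -> : j = i by apply: val_inj.
  by rewrite eqxx mulrAC mulfV // mul1r subrr (negPf ki).
have := fixO j mj => /rowP fj.
have := fj i; have := fj k; rewrite !mxE eqxx /= => -> ->.
have -> : (j == i) = false by rewrite -val_eqE /= gtn_eqF.
by rewrite [i == j]eq_sym -[j == i]val_eqE /= gtn_eqF // addr0 !mul0r subr0.
Qed.

End TraceFormula.

(* Gram-Schmidt writes [A = L *m Q] with [L] triangular and [Q] unitary. *)
Lemma hadamard (F : numClosedFieldType) n (A : 'M[F]_n) :
  `|\det A| ^+ 2 <= \prod_i \sum_j `|A i j| ^+ 2.
Proof.
pose Q := schmidt A; pose L := A *m map_mx Num.conj Q^T.
have uQ : Q \is unitarymx by apply: schmidt_unitarymx.
have QQ : Q *m map_mx Num.conj Q^T = 1%:M by apply/unitarymxP.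
have AL : A = L *m Q by rewrite /L -mulmxA (mulmx1C QQ) mulmx1.
(* Row [i] of [A] lies in the span of the rows of [Q] up to [i], hence is orthogonal to the later
   ones. *)
have Ltrig (i j : 'I_n) : (i < j)%N -> L i j = 0.
  move=> ij; have /sub_sumsmxP[u /(congr1 (fun v => (v *m map_mx Num.conj Q^T) 0 j))] :=
    row_schmidt_sub A i.
  rewrite -row_mul mxE => ->; rewrite mulmx_suml summxE big1 // => k ki.
  have /submxP[D ->] : (u k *m <<row k (schmidt A)>>%MS <= row k Q)%MS.
    by rewrite (submx_trans (submxMl _ _)) // genmxE.
  rewrite -mulmxA -row_mul QQ row1 mxE big1 // => l _.
  have kj : (j == k) = false by rewrite -val_eqE gtn_eqF //= (leq_ltn_trans ki).
  by rewrite !mxE kj andbF mulr0.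
have detL : \det L = \prod_i L i i.
  by apply: det_trig; apply/is_trig_mxP.
have detQ : `|\det Q| ^+ 2 = 1.
  have := congr1 determinant QQ; rewrite det_mulmx det1 det_map_mx det_tr => <-.
  by rewrite normCK.
rewrite {1}AL det_mulmx normrM exprMn detQ mulr1 detL normr_prod -prodrXl.
apply: ler_prod => i _; rewrite exprn_ge0 ?normr_ge0 //=.
have -> : \sum_j `|A i j| ^+ 2 = \sum_j `|L i j| ^+ 2.
  have diag (B : 'M[F]_n) : \sum_j `|B i j| ^+ 2 = (B *m map_mx Num.conj B^T) i i.
    by rewrite mxE; apply: eq_bigr => j _; rewrite !mxE normCK.
  rewrite !diag {1 2}AL trmx_mul map_mxM mulmxA; congr (_ i i).
  by rewrite -[L *m Q *m _]mulmxA QQ mulmx1.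
by rewrite (bigD1 i) //= lerDl sumr_ge0 // => j _; rewrite exprn_ge0.
Qed.

Lemma hadamard_real (R : realType) n (A : 'M[R]_n) :
  (\det A) ^+ 2 <= \prod_i \sum_j A i j ^+ 2.
Proof.
have sq (x : R) : `|x%:C| ^+ 2 = (x ^+ 2)%:C.
  by rewrite -add_Re2_Im2 /= expr0n addr0.
have := hadamard (map_mx (real_complex R) A); rewrite det_map_mx sq.
rewrite (_ : \prod_i _ = (\prod_i \sum_j A i j ^+ 2)%:C) ?lecR //.
rewrite rmorph_prod; apply: eq_bigr => i _; rewrite rmorph_sum.
by apply: eq_bigr => j _; rewrite mxE sq.
Qed.

Section TraceBound.
Variables (R : realType) (n : nat).
Local Notation C := R[i].
Implicit Types (U : qop R n) (O : 'M[R]_(2 * n)).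

Lemma orth_entry_bound O i : O *m O^T = 1%:M -> 0 <= 1 + O i i.
Proof.
move=> OO; have := dot_row O i i; rewrite OO mxE eqxx.
rewrite /dot (bigD1 i) //= !mxE => e.
have : 0 <= \sum_(j | j != i) row i O 0 j * row i O 0 j.
  by apply: sumr_ge0 => j _; rewrite -expr2 sqr_ge0.
move: e; set S := \sum_(_ | _) _; set x := O i i => e S0.
have T1 : true%:R = 1 :> R by [].
rewrite T1 in e; nra.
Qed.

(** Row [i] of [1 + O] is a sum of two unit vectors with inner product [O_ii], so its squared length
    is [2 + 2 O_ii]. *)
Lemma gaussian_trace_bound U O : U \is unitarymx -> implements U O ->
  `|(\tr U : C)| ^+ 4 <= (\prod_i ((1 + O i i) *+ 2))%:C.
Proof.
move=> uU UO; rewrite -[4%N]/(2 * 2)%N exprM (gaussian_trace uU UO) -rmorphXn lecR.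
apply: le_trans (hadamard_real _) _; apply: ler_prod => i _.
rewrite sumr_ge0 => [|j _]; last exact: sqr_ge0.
have OO := implements_orth uU UO.
suff -> : \sum_j (1%:M + O) i j ^+ 2 = (1 + O i i) *+ 2 by rewrite lexx.
have e : forall v : 'rV[R]_(2 * n), \sum_j v 0 j ^+ 2 = dot v v.
  by move=> v; apply: eq_bigr => j _; rewrite expr2.
transitivity (\sum_j (delta_mx 0 i + row i O : 'rV_(2 * n)) 0 j ^+ 2).
  by apply: eq_bigr => j _; rewrite !mxE eqxx eq_sym.
rewrite e dotD !(dotC _ (_ + _)) !dotD dot_row OO !dot_delta (dotC (row i O)).
rewrite dot_delta !mxE !eqxx /=.
have T1 : true%:R = 1 :> R by [].
by rewrite ?T1; ring.
Qed.

End TraceBound.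

(** * Gaussian unitaries *)

Section GaussianClosure.
Variable R : realType.
Local Notation C := R[i].
Implicit Types m n : nat.

Lemma gam_mulmx n (x : 'rV[R]_(2 * n)) (O : 'M[R]_(2 * n)) :
  gam (x *m O) = \sum_j (x 0 j)%:C *: gam (row j O).
Proof.
rewrite /gam; under [RHS]eq_bigr do rewrite scaler_sumr.
rewrite exchange_big /=; apply: eq_bigr => k _.
rewrite mxE rmorph_sum scaler_suml; apply: eq_bigr => j _.
by rewrite mxE scalerA rmorphM.
Qed.

Lemma implements_gam n (U : qop R n) O x :
  implements U O -> U *m gam x = gam (x *m O) *m U.
Proof.
move=> UO; rewrite gam_mulmx /gam mulmx_sumr mulmx_suml; apply: eq_bigr => j _.
by rewrite -scalemxAr UO scalemxAl.
Qed.

Lemma gaussianP n (U : qop R n) :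
  gaussian_unitary U <-> U \is unitarymx /\ exists O, implements U O.
Proof.
split=> [[uU [O _ UO]]|[uU [O UO]]]; split=> //.
  exists O => j; rewrite -[LHS]mulmx1 -(unitary_adjl uU) mulmxA UO; congr (_ *m _).
  by apply: eq_bigr => k _; rewrite mxE.
exists O => [|j]; first exact: implements_orth uU UO.
rewrite UO -mulmxA (unitaryP _ uU) mulmx1.
by apply: eq_bigr => k _; rewrite mxE.
Qed.

(** It is enough that conjugation preserves the real span of the Majorana operators: orthogonality
    comes from [implements_orth]. *)
Lemma gaussian_span n (U : qop R n) : U \is unitarymx ->
  (forall j, exists r, U *m majorana R j = gam r *m U) -> gaussian_unitary U.
Proof.
move=> uU /choice[r Ur]; apply/gaussianP; split=> //.
by exists (\matrix_j r j) => j; rewrite rowK Ur.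
Qed.

Lemma gaussian_one n : gaussian_unitary (1%:M : qop R n).
Proof.
apply: gaussian_span => [|j]; first by apply/unitaryP; rewrite adjoint_one mulmx1.
by exists (delta_mx 0 j); rewrite gam_delta mul1mx mulmx1.
Qed.

Lemma gaussian_mul n (U V : qop R n) :
  gaussian_unitary U -> gaussian_unitary V -> gaussian_unitary (U *m V).
Proof.
move=> /gaussianP[uU [O UO]] /gaussianP[uV [O' VO']].
apply: gaussian_span => [|j]; first exact: mul_unitarymx.
exists (row j O' *m O); rewrite -mulmxA VO' !mulmxA.
by rewrite (implements_gam _ UO).
Qed.

Lemma adjoint_unitary n (U : 'M[C]_n) : U \is unitarymx -> adjoint U \is unitarymx.
Proof. by move=> uU; apply/unitaryP; rewrite adjointK unitary_adjl. Qed.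

Lemma gaussian_adjoint n (U : qop R n) : gaussian_unitary U -> gaussian_unitary (adjoint U).
Proof.
move=> /gaussianP[uU [O UO]]; have OO := implements_orth uU UO.
apply: gaussian_span => [|j]; first exact: adjoint_unitary.
exists (row j O^T); rewrite -[RHS]mul1mx -(unitary_adjl uU) mulmxA.
rewrite -[adjoint U *m U *m _]mulmxA (implements_gam _ UO) -row_mul (mulmx1C OO) row1 gam_delta.
by rewrite -!mulmxA (unitaryP _ uU) mulmx1.
Qed.

(** The conjugated parity [Q] anticommutes with the images of the modes, hence with all modes, so
    parity times [Q] is a scalar, and [Q] squared being 1 makes it a sign. It must be real to enter
    an orthogonal matrix in [gaussian_qt]. *)
Lemma gaussian_parity n (U : qop R n) : gaussian_unitary U ->
  exists e : R, U *m parity R n = e%:C *: parity R n *m U.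
Proof.
move=> /gaussianP[uU [O UO]]; have OO := implements_orth uU UO.
have [Q Qdef] : {Q | Q = U *m parity R n *m adjoint U} by exists (U *m parity R n *m adjoint U).
have QO j : Q *m gam (row j O) = - (gam (row j O) *m Q).
  have -> : gam (row j O) = U *m majorana R j *m adjoint U.
    by rewrite UO -mulmxA (unitaryP _ uU) mulmx1.
  rewrite Qdef !mulmxA -[_ *m adjoint U *m U]mulmxA unitary_adjl // mulmx1.
  rewrite -[_ *m adjoint U *m U]mulmxA unitary_adjl // mulmx1.
  rewrite -[U *m _ *m _]mulmxA parity_majorana mulmxN mulNmx.
  by rewrite !mulmxA.
have Qm k : Q *m majorana R k = - (majorana R k *m Q).
  have -> : majorana R k = gam (row k O^T *m O).
    by rewrite -row_mul (mulmx1C OO) row1 gam_delta.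
  rewrite gam_mulmx mulmx_sumr mulmx_suml -sumrN; apply: eq_bigr => j _.
  by rewrite -scalemxAr QO scalerN scalemxAl.
have [k|a Qa] := @majorana_irreducible R n (parity R n *m Q).
  rewrite -[RHS]mulmxA Qm mulmxN mulmxA -[majorana R k *m _]opprK -parity_majorana.
  by rewrite mulNmx mulmxA.
have QE : Q = a *: parity R n.
  by rewrite -[Q]mul1mx -(parityM R n) -mulmxA Qa mul_mx_scalar.
have a2 : a ^+ 2 = 1.
  have : Q *m Q = 1%:M.
    rewrite Qdef !mulmxA -[_ *m adjoint U *m U]mulmxA unitary_adjl // mulmx1.
    by rewrite -[U *m _ *m _]mulmxA parityM mulmx1; apply/unitaryP.
  rewrite QE -scalemxAl -scalemxAr parityM scalerA scalemx1 -expr2.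
  by rewrite -[1%:M]/(1%:M : qop R n) => /scalar_mx_inj.
have [e ea] : exists e : R, a = e%:C.
  move/eqP: a2; rewrite sqrf_eq1 => /orP[] /eqP ->; first by exists 1.
  by exists (-1); rewrite rmorphN1.
exists e; rewrite -ea -QE Qdef -!mulmxA unitary_adjl ?mulmx1 //.
Qed.

Lemma sum_lrsh (V : nmodType) m n (F : 'I_(2 * (m + n)) -> V) :
  \sum_k F k = \sum_i F (lsh n i) + \sum_j F (rsh m j).
Proof.
rewrite (reindex (cast_ord (esym (mulnDr 2 m n)))) ?big_split_ord //=.
by exists (cast_ord (mulnDr 2 m n)) => k _; apply: val_inj.
Qed.

Lemma gam_row_mx m n (r : 'rV[R]_(2 * m)) (s : 'rV[R]_(2 * n)) :
  gam (castmx (erefl, esym (mulnDr 2 m n)) (row_mx r s))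
  = qt (gam r) 1%:M + qt (parity R m) (gam s).
Proof.
rewrite {1}/gam sum_lrsh; congr (_ + _).
  rewrite /gam; elim/big_ind2: _ => [|A a B b -> ->|k _]; rewrite ?qt0l ?qtDl //.
  by rewrite castmxE cast_ordK cast_ord_id row_mxEl qtZl majorana_lsh.
rewrite /gam; elim/big_ind2: _ => [|A a B b -> ->|k _]; rewrite ?qt0r ?qtDr //.
by rewrite castmxE cast_ordK cast_ord_id row_mxEr qtZr majorana_rsh.
Qed.

Lemma gam0 n : gam (0 : 'rV[R]_(2 * n)) = 0.
Proof. by rewrite /gam big1 // => k _; rewrite mxE scale0r. Qed.

Lemma gam_lsh m n (r : 'rV[R]_(2 * m)) : exists s, qt (gam r) (1%:M : qop R n) = gam s.
Proof. by eexists; rewrite -[LHS]addr0 -[X in _ + X](qt0r n (parity R m)) -gam0 -gam_row_mx. Qed.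

Lemma gam_rsh m n (r : 'rV[R]_(2 * n)) : exists s, qt (parity R m) (gam r) = gam s.
Proof. by eexists; rewrite -[LHS]add0r -[X in X + _](qt0l m 1%:M) -gam0 -gam_row_mx. Qed.

(* [U] commutes or anticommutes with the parity, that is with the Jordan-Wigner
   strings of the second factor; the sign [e] goes into the orthogonal matrix. *)
Lemma gaussian_qt m n (U : qop R m) (V : qop R n) :
  gaussian_unitary U -> gaussian_unitary V -> gaussian_unitary (qt U V).
Proof.
move=> gU gV; have [e Ue] := gaussian_parity gU.
have /gaussianP[uU [O UO]] := gU; have /gaussianP[uV [O' VO']] := gV.
apply: gaussian_span => [|j]; first exact: qt_unitary.
case: (lrshP j) => i ->.
  have [s es] := gam_lsh n (row i O); exists s.
  by rewrite majorana_lsh -es !qtM UO mulmx1 mul1mx.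
have [s es] := gam_rsh m (row i O'); exists (e *: s).
have -> : gam (e *: s) = e%:C *: gam s.
  by rewrite /gam scaler_sumr; apply: eq_bigr => k _; rewrite mxE rmorphM scalerA.
by rewrite majorana_rsh -es !qtM Ue VO' -scalemxAl !qtZl -scalemxAl qtM.
Qed.

Lemma gaussian_pk m n (U : qop R m) (V : qop R n) :
  m = n -> pk U = pk V -> gaussian_unitary U -> gaussian_unitary V.
Proof. by move=> mn; case: n / mn V => V /pk_inj ->. Qed.

Lemma pk_tens_pow n (V : qop R n) t : pk (tens_pow V t) = pk (ntensmx V t).
Proof. exact: pk_cast. Qed.

Lemma pk_tens_powS n (V : qop R n) t : pk (tens_pow V t.+1) = pk (qt V (tens_pow V t)).
Proof. by rewrite pk_qt !pk_tens_pow pk_ntensS. Qed.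

Lemma gaussian_tens_pow n (V : qop R n) t :
  gaussian_unitary V -> gaussian_unitary (tens_pow V t).
Proof.
move=> gV; elim: t => [|t IH].
  apply: (@gaussian_pk 0 (n * 0) 1%:M); rewrite ?muln0 //; last exact: gaussian_one.
  by rewrite pk_tens_pow.
apply: (@gaussian_pk (n + n * t) (n * t.+1) (qt V (tens_pow V t))).
- by rewrite mulnS.
- by rewrite pk_tens_powS.
exact: gaussian_qt.
Qed.

End GaussianClosure.

(** * The witness functional *)

(** Indices with quotient [b] by 4 are the modes of the qubits [2b] and [2b + 1], counted from 0. *)
Lemma card_block N b : (4 * b.+1 <= N)%N -> #|[pred i : 'I_N | (i %/ 4)%N == b]| = 4.
Proof.
move=> bN; have h (r : 'I_4) : (4 * b + r < N)%N by have := ltn_ord r; lia.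
pose f r := Ordinal (h r).
rewrite -[RHS](card_ord 4) -(@card_codom _ _ f) => [|r s [/addnI]]; last exact: val_inj.
apply: eq_card => i; rewrite inE; apply/eqP/codomP => [ib|[r ->] /=].
  have r4 : (i %% 4 < 4)%N by rewrite ltn_mod.
  by exists (Ordinal r4); apply: val_inj => /=; rewrite -ib mulnC -divn_eq.
by have := ltn_ord r; lia.
Qed.

Section Witness.
Variable R : realType.
Local Notation C := R[i].

Definition block_weight N b (O : 'M[R]_N) : R :=
  (\sum_(i < N | (i %/ 4)%N == b) (1 + O i i)) / 2.

Lemma gaussian_trace_blocks t (U : qop R (2 * t)) O :
  U \is unitarymx -> implements U O ->
  `|(\tr U : C)| <= (\prod_(b < t) block_weight b O)%:C.
Proof.
move=> uU UO; have OO := implements_orth uU UO.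
have w0 b : 0 <= block_weight b O.
  by rewrite divr_ge0 ?ler0n // sumr_ge0 // => i _; apply: orth_entry_bound.
have P0 : 0 <= \prod_(b < t) block_weight b O by apply: prodr_ge0.
rewrite -(@ler_pXn2r _ 4) ?nnegrE ?normr_ge0 ?ler0c //.
apply: le_trans (gaussian_trace_bound uU UO) _.
rewrite -rmorphXn lecR -prodrXl.
have ib (i : 'I_(2 * (2 * t))) : (i %/ 4 < t)%N by have := ltn_ord i; lia.
rewrite (partition_big (fun i => Ordinal (ib i)) xpredT) //=.
apply: ler_prod => b _; apply/andP; split.
  by apply: prodr_ge0 => i _; rewrite mulrn_wge0 // orth_entry_bound.
(* Four factors yield the fourth power of their mean, and the mean of the [2 + 2 O_ii] is the block
   weight. *)
have := @leif_AGM R _ [pred i : 'I_(2 * (2 * t)) | (i %/ 4)%N == b] (fun i => (1 + O i i) *+ 2).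
rewrite card_block; last by have := ltn_ord b; lia.
case=> [i _|+ _]; first by rewrite mulrn_wge0 // orth_entry_bound.
rewrite sumrMnl; set S := \sum_(_ in _) _.
have -> : block_weight b O = S *+ 2 / 4%:R.
  by rewrite /block_weight -/S -mulr_natr; field.
by [].
Qed.

Definition zz : qop R 2 := pauliZ R *t pauliZ R.

Lemma zz_parity : zz = parity R 2. Proof. by []. Qed.

(** Earlier modes do not touch block [k], and later ones act on it by the string ZZ, which commutes
    with [zz]; only the four modes of the block anticommute. *)
Lemma block_parity_majorana k m (i : 'I_(2 * (2 * k + (2 + 2 * m)))) :
  let Q := qt (1%:M : qop R (2 * k)) (qt zz (1%:M : qop R (2 * m))) in
  Q *m majorana R i = (-1) ^+ ((i %/ 4)%N == k) *: (majorana R i *m Q).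
Proof.
move=> Q; rewrite /Q; case: (lrshP i) => j ->.
  rewrite majorana_lsh !qtM !mul1mx !mulmx1.
  have -> : (((lsh (2 + 2 * m) j : nat) %/ 4)%N == k) = false by apply/eqP => /=; have := ltn_ord j; lia.
  by rewrite expr0 scale1r.
rewrite majorana_rsh; case: (lrshP j) => l ->.
  rewrite majorana_lsh !qtM !mul1mx !mulmx1 zz_parity parity_majorana.
  have -> : (((rsh (2 * k) (lsh (2 * m) l) : nat) %/ 4)%N == k) by apply/eqP => /=; have := ltn_ord l; lia.
  by rewrite expr1 scaleN1r qtNl qtNr.
rewrite majorana_rsh !qtM !mul1mx !mulmx1 zz_parity.
have -> : (((rsh (2 * k) (rsh 2 l) : nat) %/ 4)%N == k) = false by apply/eqP => /=; lia.
by rewrite expr0 scale1r.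
Qed.

Lemma zz_unitary : zz \is unitarymx.
Proof. exact: parity_unitary. Qed.

Lemma unitarymx1 n : (1%:M : 'M[C]_n) \is unitarymx.
Proof. by apply/unitaryP; rewrite adjoint_one mulmx1. Qed.

(** The first [k] factors are already expanded and leave their block weights in the bound; each of
    the other [m] contributes 4. The size [n] is tied to [k + m] by an equation so that the same
    operators can be reread with [k.+1] and [m]. *)
Lemma witness_bound (z : C) : `|z| <= 1 ->
  forall m k n (W K : qop R n) O, n = (2 * (k + m))%N ->
  pk W = pt (pk (1%:M : qop R (2 * k))) (pk (tens_pow (1%:M + z *: zz) m)) ->
  K \is unitarymx -> implements K O ->
  `|(\tr (W *m K) : C)| <= (\prod_(b < k) block_weight b O * 4 ^+ m)%:C.
Proof.
move=> z1; elim=> [|m IH] k n W K O en eW uK KO.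
  have ek : n = (2 * k)%N by rewrite en addn0.
  clear en.
  subst n; have -> : W = 1%:M.
    by apply: pk_inj; rewrite eW pk_tens_pow pk_ntens0 pt1.
  by rewrite mul1mx mulr1; apply: gaussian_trace_blocks.
have ek : n = (2 * k + (2 + 2 * m))%N by rewrite en; lia.
clear en.
subst n.
set T := tens_pow (1%:M + z *: zz) m.
pose W' : qop R (2 * k + (2 + 2 * m)) := qt 1%:M (qt 1%:M T).
pose Q : qop R (2 * k + (2 + 2 * m)) := qt 1%:M (qt zz 1%:M).
have WE : W = W' + z *: (W' *m Q).
  have -> : W = qt 1%:M (qt (1%:M + z *: zz) T).
    by apply: pk_inj; rewrite eW pk_tens_powS -pk_qt.
  by rewrite /W' /Q !qtM !mul1mx mulmx1 qtDl qtZl qtDr qtZr.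
have eW' : pk W' = pt (pk (1%:M : qop R (2 * k.+1))) (pk T).
  rewrite !pk_qt ptA pt11; congr (pt _ _); apply: pk_one_eq.
  by rewrite -expnD mulnSr.
have uQ : Q \is unitarymx by rewrite !qt_unitary ?unitarymx1 ?zz_unitary.
(* Multiplying by [Q] on the left flips the columns of block [k], hence its diagonal entries. *)
pose O' : 'M[R]_(2 * (2 * k + (2 + 2 * m))) := \matrix_(j, i) (O j i * (-1) ^+ ((i %/ 4)%N == k)).
have QKO : implements (Q *m K) O'.
  move=> j; rewrite -mulmxA KO !mulmxA; congr (_ *m _).
  rewrite /gam mulmx_sumr mulmx_suml; apply: eq_bigr => i _.
  rewrite -scalemxAr block_parity_majorana scalerA -scalemxAl !mxE.
  by rewrite rmorphM rmorphXn rmorphN1.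
have e1 : (2 * k + (2 + 2 * m) = 2 * (k.+1 + m))%N by lia.
have B1 := IH k.+1 _ W' K O e1 eW' uK KO.
have B2 := IH k.+1 _ W' (Q *m K) O' e1 eW' (mul_unitarymx uQ uK) QKO.
rewrite WE mulmxDl -scalemxAl raddfD /= mxtraceZ -mulmxA.
apply: le_trans (ler_normD _ _) _; rewrite normrM.
apply: le_trans (lerD B1 (le_trans (ler_wpM2r (normr_ge0 _) z1) _)) _.
  by rewrite mul1r; exact: B2.
rewrite -rmorphD lecR !big_ord_recr /=.
have -> : \prod_(b < k) block_weight b O' = \prod_(b < k) block_weight b O.
  apply: eq_bigr => b _; rewrite /block_weight; congr (_ / _).
  apply: eq_bigr => i /eqP ib; rewrite mxE.
  by rewrite ib ltn_eqF ?mulr1.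
(* Each of the four modes contributes [(1 + O_ii) + (1 - O_ii) = 2], and the weight halves the
   sum. *)
have w4 : block_weight k O + block_weight k O' = 4.
  rewrite /block_weight -mulrDl -big_split /=.
  rewrite (eq_bigr (fun=> 2)) => [|i /eqP ib]; last by rewrite mxE ib eqxx; ring.
  rewrite sumr_const card_block; last by lia.
  by field.
by rewrite -mulrDl -mulrDr w4 exprS mulrA.
Qed.

End Witness.

(** * Fermionic two-qubit unitaries *)

Section TwoQubits.
Variable R : realType.
Local Notation C := R[i].
Local Notation "x ^~" := (Num.conj x) (at level 2, format "x ^~").

(** Entries are functions on [nat], so that they compute at numerals and a matrix identity becomes
    sixteen goals for [ring]. *)
Definition mk2 (f : nat -> nat -> C) : 'M[C]_2 := \matrix_(i, j) f i j.
Definition mk4 (f : nat -> nat -> C) : qop R 2 := \matrix_(i, j) f i j.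

Lemma mk4_ext f g :
  [/\ f 0 0 = g 0 0, f 0 1 = g 0 1, f 0 2 = g 0 2 & f 0 3 = g 0 3]%N ->
  [/\ f 1 0 = g 1 0, f 1 1 = g 1 1, f 1 2 = g 1 2 & f 1 3 = g 1 3]%N ->
  [/\ f 2 0 = g 2 0, f 2 1 = g 2 1, f 2 2 = g 2 2 & f 2 3 = g 2 3]%N ->
  [/\ f 3 0 = g 3 0, f 3 1 = g 3 1, f 3 2 = g 3 2 & f 3 3 = g 3 3]%N ->
  mk4 f = mk4 g.
Proof.
move=> [? ? ? ?] [? ? ? ?] [? ? ? ?] [? ? ? ?]; apply/matrixP => i j; rewrite !mxE.
case: i => [[|[|[|[|i]]]] hi]; last by exfalso; move: hi; rewrite ltnNge.
all: case: j => [[|[|[|[|j]]]] hj] //; by exfalso; move: hj; rewrite ltnNge.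
Qed.

Lemma mk4_inj f g i j : (i < 4)%N -> (j < 4)%N -> mk4 f = mk4 g -> f i j = g i j.
Proof.
move=> hi hj /matrixP/(_ (Ordinal (hi : (i < 2 ^ 2)%N)) (Ordinal (hj : (j < 2 ^ 2)%N))).
by rewrite !mxE.
Qed.

Lemma mk4_onto (A : qop R 2) : exists f, A = mk4 f.
Proof.
exists (fun i j => A (inord i : 'I_3.+1) (inord j : 'I_3.+1)).
by apply/matrixP => i j; rewrite mxE; congr (A _ _); apply: val_inj; rewrite /= inordK.
Qed.

Lemma mk4M f g : mk4 f *m mk4 g =
  mk4 (fun i j => f i 0%N * g 0%N j + f i 1%N * g 1%N j + f i 2%N * g 2%N j
    + f i 3%N * g 3%N j).
Proof.
by apply/matrixP => i j; rewrite !mxE !big_ord_recl big_ord0 /= !mxE addr0 !addrA.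
Qed.

Lemma mk4D f g : mk4 f + mk4 g = mk4 (fun i j => f i j + g i j).
Proof. by apply/matrixP => i j; rewrite !mxE. Qed.

Lemma mk4Z a f : a *: mk4 f = mk4 (fun i j => a * f i j).
Proof. by apply/matrixP => i j; rewrite !mxE. Qed.

Lemma adjoint_mk4 f : adjoint (mk4 f) = mk4 (fun i j => (f j i)^~).
Proof. by apply/matrixP => i j; rewrite !mxE. Qed.

Lemma mk4_one : 1%:M = mk4 (fun i j => if i == j then 1 else 0).
Proof. by apply/matrixP => i j; rewrite !mxE -val_eqE /=; case: eqP. Qed.

Lemma mk2_tens f g : mk2 f *t mk2 g =
  mk4 (fun i j => f (i %/ 2)%N (j %/ 2)%N * g (i %% 2)%N (j %% 2)%N).
Proof. by apply/matrixP => i j; rewrite !mxE. Qed.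

Definition mx2 (a b c d : C) : 'M[C]_2 := mk2 (fun i j =>
  match i, j with
  | 0%N, 0%N => a | 0%N, 1%N => b | 1%N, 0%N => c | 1%N, 1%N => d | _, _ => 0 end).

Lemma pauliXE : pauliX R = mx2 0 1 1 0.
Proof. by apply: matrix2P; rewrite !mxE /= ?addr0 ?add0r. Qed.
Lemma pauliYE : pauliY R = mx2 0 (- 'i) 'i 0.
Proof. by apply: matrix2P; rewrite !mxE /= ?mulr0 ?mulr1 ?addr0 ?add0r. Qed.
Lemma pauliZE : pauliZ R = mx2 1 0 0 (- 1).
Proof. by apply: matrix2P; rewrite !mxE /= ?subr0 ?sub0r. Qed.
Lemma mx2_one : 1%:M = mx2 1 0 0 1.
Proof. by apply: matrix2P; rewrite !mxE. Qed.

Lemma qt2 (A B : 'M[C]_2) : qt (A : qop R 1) (B : qop R 1) = A *t B.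
Proof. by apply: pk_inj; rewrite pk_qt. Qed.

(* The real span of the Majorana operators on two qubits. *)
Definition odd4 (u w : C) : qop R 2 := mk4 (fun i j => match i, j with
  | 0%N, 1%N => w | 0%N, 2%N => u | 1%N, 0%N => w^~ | 1%N, 3%N => u
  | 2%N, 0%N => u^~ | 2%N, 3%N => - w | 3%N, 1%N => u^~ | 3%N, 2%N => - w^~ | _, _ => 0 end).

Lemma gam1 (a b : R) : gam (\row_(k < 2 * 1) (if odd k then b else a))
  = mx2 0 (a%:C - b%:C * 'i) (a%:C + b%:C * 'i) 0 :> 'M[C]_2.
Proof.
rewrite /gam !big_ord_recl big_ord0 addr0 !majorana1 /= !mxE /= pauliXE pauliYE.
by apply: matrix2P; rewrite !mxE /= ?mulr0 ?mulr1 ?addr0 // mulrN.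
Qed.

Lemma conj_rect (a b : R) : (a%:C - b%:C * 'i)^~ = a%:C + b%:C * 'i.
Proof.
have cr (x : R) : (x%:C)^~ = x%:C by exact: conjc_real.
by rewrite rmorphB rmorphM /= conj_i mulrN opprK !cr.
Qed.

Lemma conj0 : (0 : C)^~ = 0. Proof. exact: rmorph0. Qed.
Lemma conj1 : (1 : C)^~ = 1. Proof. exact: rmorph1. Qed.
Lemma conj_Ni : (- 'i : C)^~ = 'i.
Proof. by rewrite rmorphN /= conj_i opprK. Qed.

Lemma odd4_gam u w : exists r, odd4 u w = gam r.
Proof.
have rect (z : C) : exists a b : R, z = a%:C - b%:C * 'i.
  by exists (complex.Re z), (- complex.Im z); rewrite rmorphN mulNr opprK mulrC -complexE.
have [a [b ->]] := rect u; have [c [d ->]] := rect w.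
exists (castmx (erefl, esym (mulnDr 2 1 1)) (row_mx
  (\row_(k < 2 * 1) (if odd k then b else a)) (\row_(k < 2 * 1) (if odd k then d else c)))).
rewrite (@gam_row_mx R 1 1) !gam1 !qt2.
have -> : parity R 1 = mx2 1 0 0 (- 1) by rewrite -pauliZE.
rewrite mx2_one !mk2_tens mk4D.
by apply: mk4_ext; split; rewrite /= ?conj_rect; ring.
Qed.

Lemma majorana_odd4 (k : 'I_(2 * (1 + 1))) : exists u w, majorana R k = odd4 u w.
Proof.
case: (@lrshP 1 1 k) => i ->; rewrite (majorana_lsh, majorana_rsh) majorana1 qt2.
  rewrite mx2_one; case: ifP => _.
    exists (- 'i), 0; rewrite pauliYE mk2_tens.
    by apply: mk4_ext; split; rewrite /= ?conj_Ni ?conj0; ring.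
  exists 1, 0; rewrite pauliXE mk2_tens.
  by apply: mk4_ext; split; rewrite /= ?conj1 ?conj0; ring.
have -> : parity R 1 = mx2 1 0 0 (- 1) by rewrite -pauliZE.
case: ifP => _.
  exists 0, (- 'i); rewrite pauliYE mk2_tens.
  by apply: mk4_ext; split; rewrite /= ?conj_Ni ?conj0; ring.
exists 0, 1; rewrite pauliXE mk2_tens.
by apply: mk4_ext; split; rewrite /= ?conj1 ?conj0; ring.
Qed.

(* The pair of SU(2) elements with first rows [p, q] and [r, s], acting on the
   even and on the odd parity subspace. *)
Definition su2_pair (p q r s : C) : qop R 2 := mk4 (fun i j => match i, j with
  | 0%N, 0%N => p | 0%N, 3%N => q | 3%N, 0%N => - q^~ | 3%N, 3%N => p^~
  | 1%N, 1%N => r | 1%N, 2%N => s | 2%N, 1%N => - s^~ | 2%N, 2%N => r^~ | _, _ => 0 end).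

(** The double cover of SO(4) by SU(2) x SU(2): conjugation by such a pair preserves the real
    four-dimensional space of the [odd4]. *)
Lemma su2_pair_gaussian p q r s :
  p * p^~ + q * q^~ = 1 -> r * r^~ + s * s^~ = 1 -> gaussian_unitary (su2_pair p q r s).
Proof.
move=> pq rs; have uG : su2_pair p q r s \is unitarymx.
{ apply/unitaryP; rewrite adjoint_mk4 mk4M mk4_one.
  apply: mk4_ext; split; rewrite /= ?(conj0, rmorphN) /= ?conjCK.
  1-4,13-16: by rewrite -?pq; ring.
  all: by rewrite -?rs; ring. }
apply: gaussian_span => // k; have [u [w ->]] : exists u w, majorana R k = odd4 u w := majorana_odd4 k.
(* The two arguments are the entries (0, 2) and (0, 1) of the conjugated matrix. *)
have [x ex] := odd4_gam (p * (u * r - w * s) - q * (u^~ * s + w^~ * r))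
  (p * (w * r^~ + u * s^~) + q * (u^~ * r^~ - w^~ * s^~)).
exists x; rewrite -[LHS]mulmx1 -(unitary_adjl uG) mulmxA; congr (_ *m _).
rewrite -ex adjoint_mk4 !mk4M.
by apply: mk4_ext; split; rewrite /= ?(conj0, rmorphN, rmorphD, rmorphB, rmorphM) /= ?conjCK; ring.
Qed.

End TwoQubits.

Section TwoQubitStructure.
Variable R : realType.
Local Notation C := R[i].
Local Notation "x ^~" := (Num.conj x) (at level 2, format "x ^~").

(** A unitary 2 x 2 matrix is a phase times an element of SU(2); the phase is a square root of the
    determinant [D]. *)
Lemma u2_rect (a b c d : C) : a * a^~ + b * b^~ = 1 -> a * c^~ + b * d^~ = 0 ->
  c * c^~ + d * d^~ = 1 -> exists s p q,
  [/\ p * p^~ + q * q^~ = 1, a = s * p, b = s * q, c = - (s * q^~) & d = s * p^~].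
Proof.
move=> ab abcd cd; pose D := a * d - b * c.
have cdab : c * a^~ + d * b^~ = 0.
  by have := congr1 Num.conj abcd; rewrite conj0 rmorphD !rmorphM /= !conjCK => <-; ring.
have dE : d = D * a^~.
  transitivity (d * (a * a^~ + b * b^~)); first by rewrite ab mulr1.
  transitivity (D * a^~ + b * (c * a^~ + d * b^~)); first by rewrite /D; ring.
  by rewrite cdab mulr0 addr0.
have cE : c = - (D * b^~).
  transitivity (c * (a * a^~ + b * b^~)); first by rewrite ab mulr1.
  transitivity (- (D * b^~) + a * (c * a^~ + d * b^~)); first by rewrite /D; ring.
  by rewrite cdab mulr0 addr0.
have DD : D * D^~ = 1.
  rewrite -cd {1 2}cE {1 2}dE !rmorphN !rmorphM /= !conjCK.
  transitivity (D * D^~ * (a * a^~ + b * b^~)); first by rewrite ab mulr1.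
  by ring.
pose s := sqrtC D.
have sD : s * s = D by rewrite -expr2 sqrtCK.
have ss : s * s^~ = 1.
  apply/eqP; rewrite -normCK -(eqrXn2 (n := 2)) ?exprn_ge0 //.
  by rewrite expr1n -exprM -[(2 * 2)%N]/4%N; move: DD; rewrite -normCK -sD normrM -expr2 -exprM => ->.
exists s, (s^~ * a), (s^~ * b); rewrite !rmorphM /= !conjCK !mulrA !sD; split=> //.
- transitivity (s * s^~ * (a * a^~ + b * b^~)); first by ring.
  by rewrite ss ab mulr1.
- by rewrite ss mul1r.
- by rewrite ss mul1r.
Qed.

(** Commuting with ZZ splits [V] into an even and an odd 2 x 2 unitary. Their SU(2) parts form the
    Gaussian factor, and the two remaining phases are a combination of 1 and ZZ. *)
Lemma fermionic_decomposition (V : qop R 2) : V \is unitarymx -> fermionic2 V ->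
  exists G a b, gaussian_unitary G /\ V = G *m (a%:M + b *: zz R).
Proof.
have [f ->] := mk4_onto V => /unitaryP; rewrite /fermionic2 /comm_mx.
rewrite pauliZE mk2_tens adjoint_mk4 !mk4M mk4_one => uV cV.
have z (x : C) : x = - x -> x = 0.
  by move/eqP; rewrite -subr_eq0 opprK -mulr2n mulrn_eq0 => /eqP.
have Z i j (hi : (i < 4)%N) (hj : (j < 4)%N) := mk4_inj hi hj cV.
have simp := (mulr0, mul0r, mulr1, mul1r, addr0, add0r, mulrN, mulNr, @opprK C).
have z01 : f 0%N 1%N = 0.
  by apply: z; have := Z 0%N 1%N isT isT; rewrite /= !simp => e; first [exact: e | exact: esym e].
have z02 : f 0%N 2%N = 0.
  by apply: z; have := Z 0%N 2%N isT isT; rewrite /= !simp => e; first [exact: e | exact: esym e].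
have z10 : f 1%N 0%N = 0.
  by apply: z; have := Z 1%N 0%N isT isT; rewrite /= !simp => e; first [exact: e | exact: esym e].
have z13 : f 1%N 3%N = 0.
  by apply: z; have := Z 1%N 3%N isT isT; rewrite /= !simp => e; first [exact: e | exact: esym e].
have z20 : f 2%N 0%N = 0.
  by apply: z; have := Z 2%N 0%N isT isT; rewrite /= !simp => e; first [exact: e | exact: esym e].
have z23 : f 2%N 3%N = 0.
  by apply: z; have := Z 2%N 3%N isT isT; rewrite /= !simp => e; first [exact: e | exact: esym e].
have z31 : f 3%N 1%N = 0.
  by apply: z; have := Z 3%N 1%N isT isT; rewrite /= !simp => e; first [exact: e | exact: esym e].
have z32 : f 3%N 2%N = 0.
  by apply: z; have := Z 3%N 2%N isT isT; rewrite /= !simp => e; first [exact: e | exact: esym e].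
have U i j (hi : (i < 4)%N) (hj : (j < 4)%N) := mk4_inj hi hj uV.
have [|||s [p [q [pq ea eb ec ed]]]] := @u2_rect (f 0%N 0%N) (f 0%N 3%N) (f 3%N 0%N) (f 3%N 3%N).
- by have := U 0%N 0%N isT isT; rewrite /= z01 z02 !(mul0r, addr0).
- by have := U 0%N 3%N isT isT; rewrite /= z01 z02 !(mul0r, addr0).
- by have := U 3%N 3%N isT isT; rewrite /= z31 z32 !(mul0r, addr0).
have [|||u [r [t [rt fa fb fc fd]]]] := @u2_rect (f 1%N 1%N) (f 1%N 2%N) (f 2%N 1%N) (f 2%N 2%N).
- by have := U 1%N 1%N isT isT; rewrite /= z10 z13 !(mul0r, addr0, add0r).
- by have := U 1%N 2%N isT isT; rewrite /= z10 z13 !(mul0r, addr0, add0r).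
- by have := U 2%N 2%N isT isT; rewrite /= z20 z23 !(mul0r, addr0, add0r).
(* ZZ is 1 on the even and -1 on the odd subspace, so [a + b = s] and [a - b = u]. *)
exists (su2_pair p q r t), ((s + u) / 2), ((s - u) / 2).
split; first exact: su2_pair_gaussian.
rewrite -scalemx1 mk4_one /zz pauliZE mk2_tens !mk4Z mk4D mk4M.
apply: mk4_ext; split; rewrite /= ?z01 ?z02 ?z10 ?z13 ?z20 ?z23 ?z31 ?z32
  ?ea ?eb ?ec ?ed ?fa ?fb ?fc ?fd; by field.
Qed.

End TwoQubitStructure.

(** * The Choi state *)

Section Choi.
Variable R : realType.
Local Notation C := R[i].

Lemma act_middle_gaussian (K : qop R 2) :
  gaussian_unitary K -> gaussian_unitary (act_middle K).
Proof.
move=> gK; apply: (@gaussian_pk R (1 + 2 + 1) 4 (qt (qt 1%:M K) 1%:M)) => //.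
  by rewrite !pk_qt.
by apply: gaussian_qt; [apply: gaussian_qt => //; apply: gaussian_one|apply: gaussian_one].
Qed.

Let s : C := (Num.sqrt 2)^-1%:C.

Lemma sqrt2V : s * s = 2^-1.
Proof.
rewrite /s -rmorphM -invfM -expr2 sqr_sqrtr ?ler0n //.
by rewrite fmorphV rmorph_nat.
Qed.

Lemma bell_pair_gaussian : gaussian_state (bell_pair_state R : qvec R 4).
Proof.
(* The first column of [W] is [psi_plus]; on the odd subspace [W] is the identity. *)
pose W := su2_pair s (- s) 1 0.
have cs : Num.conj s = s by exact: conjc_real.
have cNs : Num.conj (- s) = - s by rewrite rmorphN /= cs.
have gW : gaussian_unitary W.
  apply: su2_pair_gaussian; rewrite ?rmorphN /= ?cs ?mulrNN ?sqrt2V.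
    by field.
  by rewrite conj1 conj0; ring.
exists (qt W W : qop R 4); first exact: (gaussian_qt gW gW).
have kE : ket_zeros R 4 = (ket0 R *t ket0 R) *t (ket0 R *t ket0 R).
  by apply: pk_inj; rewrite pk_cast !pk_ntensS pk_ntens0 pt1; apply: ptA.
have qE : (qt W W : qop R 4) = W *t W by apply: pk_inj; exact: (@pk_qt R 2 2 W W).
have -> : bell_pair_state R = (W *m (ket0 R *t ket0 R)) *t (W *m (ket0 R *t ket0 R)).
  suff -> : W *m (ket0 R *t ket0 R) = psi_plus R by [].
  apply/matrixP => i j; rewrite !mxE !big_ord_recl big_ord0 !mxE /=.
  case: i => [[|[|[|[|i]]]] hi] //; rewrite /= ?(mulr0, mulr1, addr0, mul0r, add0r) //.
  by rewrite cNs opprK.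
rewrite qE kE; exact: (@tensmx_mul C 4 4 4 4 1 1 W W (ket0 R *t ket0 R) (ket0 R *t ket0 R)).
Qed.

(** Choi-Jamiolkowski: contracting the outer qubits with basis vectors [a] and [b] leaves half of
    [A] applied to the basis vector [ab]. *)
Lemma act_middle_bell_inj (A B : qop R 2) :
  act_middle A *m bell_pair_state R = act_middle B *m bell_pair_state R -> A = B.
Proof.
pose k (a : 'I_2) : 'cV[C]_2 := delta_mx a 0.
have kk a b : (k a)^T *m k b = (a == b)%:R%:M.
  rewrite trmx_delta mul_delta_mx_cond; case: (a == b); apply/matrixP => i j;
  by rewrite !ord1 ?mulr1n ?mulr0n !mxE.
have id2 : 1%:M = \sum_a k a *m (k a)^T.
  apply/matrixP => i j; rewrite summxE mxE (bigD1 i) //= big1 => [|a ai].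
    by rewrite trmx_delta mul_delta_mx mxE eqxx addr0 andTb eq_sym.
  by rewrite trmx_delta mul_delta_mx mxE eq_sym (negPf ai).
have psiE : psi_plus R = s *: \sum_a k a *t k a :> 'M_(2 * 2, 1 * 1).
  rewrite !big_ord_recl big_ord0 addr0.
  by have -> : lift ord0 ord0 = 1 :> 'I_2 by apply: val_inj.
pose p a b : 'M[C]_(4, 16) := (k a)^T *t (1%:M : 'M_4) *t (k b)^T.
have p_bell a b : p a b *m (bell_pair_state R : 'cV_16) = s * s *: (k a *t k b : 'cV_4).
  have -> : p a b = ((k a)^T *t (1%:M : 'M_2)) *t ((1%:M : 'M_2) *t (k b)^T).
    apply: pk_inj; rewrite /p -(tensmx11 _ 2 2).
    transitivity (pt (pt (pk (k a)^T) (pt (pk (1%:M : 'M_2)) (pk (1%:M : 'M_2)))) (pk (k b)^T)) => //.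
    transitivity (pt (pt (pk (k a)^T) (pk (1%:M : 'M_2))) (pt (pk (1%:M : 'M_2)) (pk (k b)^T))) => //.
    by rewrite !ptA.
  transitivity (@mulmx C _ _ (1 * 1) ((k a)^T *t (1%:M : 'M_2)) (psi_plus R)
    *t @mulmx C _ _ (1 * 1) ((1%:M : 'M_2) *t (k b)^T) (psi_plus R)).
    exact: (@tensmx_mul C 2 4 2 4 1 1).
  have -> : @mulmx C _ _ (1 * 1) ((k a)^T *t (1%:M : 'M_2)) (psi_plus R) = s *: ((1%:M : 'M_1) *t k a).
    rewrite psiE -scalemxAr mulmx_sumr (bigD1 a) //= big1 => [|c ca].
      by rewrite addr0 tensmx_mul kk eqxx mul1mx.
    by rewrite tensmx_mul kk eq_sym (negPf ca) raddf0 tens0mx.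
  have -> : @mulmx C _ _ (1 * 1) ((1%:M : 'M_2) *t (k b)^T) (psi_plus R) = s *: (k b *t (1%:M : 'M_1)).
    rewrite psiE -scalemxAr mulmx_sumr (bigD1 b) //= big1 => [|c cb].
      by rewrite addr0 tensmx_mul kk eqxx mul1mx.
    by rewrite tensmx_mul kk eq_sym (negPf cb) raddf0 tensmx0.
  rewrite tensmxZl tensmxZr scalerA; congr (_ *: _).
  apply: pk_inj; transitivity (pt (pt (pk (1%:M : 'M_1)) (pk (k a))) (pt (pk (k b)) (pk (1%:M : 'M_1)))) => //.
  by rewrite p1t pt1.
have p_act (D : qop R 2) a b : p a b *m (act_middle D : 'M_16) = (D : 'M_4) *m p a b.
  have eD : (D : 'M_4) = (1%:M : 'M_1) *t D *t (1%:M : 'M_1).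
    apply: pk_inj; transitivity (pt (pt (pk (1%:M : 'M_1)) (pk D)) (pk (1%:M : 'M_1))) => //.
    by rewrite pt1 p1t.
  transitivity ((k a)^T *t D *t (k b)^T : 'M_(4, 16)).
    apply: (etrans (@tensmx_mul C 4 8 1 2 8 2 _ _ _ _)).
    rewrite mulmx1; congr (_ *t _); apply: (etrans (@tensmx_mul C 1 2 4 4 2 4 _ _ _ _)).
    by rewrite mulmx1 mul1mx.
  rewrite {2}eD; apply/esym; apply: (etrans (@tensmx_mul C 4 4 1 1 8 2 _ _ _ _)).
  rewrite mul1mx; congr (_ *t _); apply: (etrans (@tensmx_mul C 1 1 4 4 2 4 _ _ _ _)).
  by rewrite mulmx1 mul1mx.
move=> AB.
have AB_k a b : (A : 'M_4) *m (k a *t k b) = (B : 'M_4) *m (k a *t k b).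
  have := congr1 (mulmx (p a b)) AB; rewrite !mulmxA !p_act -!mulmxA !p_bell -!scalemxAr sqrt2V.
  by apply: scalerI; rewrite invr_eq0 pnatr_eq0.
have id4 : (1%:M : 'M[C]_4) = \sum_a \sum_b (k a *t k b) *m (k a *t k b)^T.
  rewrite -(tensmx11 _ 2 2) id2 !big_ord_recl !big_ord0 !addr0 !tensmxDl !tensmxDr.
  by rewrite !trmx_tens !tensmx_mul.
rewrite -[A]mulmx1 -[B]mulmx1.
transitivity ((A : 'M_4) *m 1%:M) => //; transitivity ((B : 'M_4) *m 1%:M) => //.
rewrite id4 !mulmx_sumr; apply: eq_bigr => a _.
by rewrite !mulmx_sumr; apply: eq_bigr => b _; rewrite !mulmxA AB_k.
Qed.

End Choi.

(** * Extents *)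

Section Extents.
Variable R : realType.
Local Notation C := R[i].

Lemma l1norm_ge0 m (c : 'I_m -> C) : 0 <= l1norm c.
Proof. by apply: sumr_ge0 => j _; rewrite -ler0c; exact: (normr_ge0 (c j)). Qed.

Lemma l1normE m (c : 'I_m -> C) : (l1norm c)%:C = \sum_j `|c j|.
Proof. by rewrite rmorph_sum. Qed.

Lemma extent_le (E : lmodType C) (D : set E) m (c : 'I_m -> C) (d : 'I_m -> E) :
  (forall j, D (d j)) -> extent D (\sum_j c j *: d j) <= l1norm c ^+ 2.
Proof.
move=> Dd; apply: ge_inf; last by exists m, c, d.
by exists 0 => r [m' [c' [d' [_ _ ->]]]]; rewrite exprn_ge0 // l1norm_ge0.
Qed.

(** The element is given as a combination of the dictionary because a lower bound passes to [inf]
    only for a nonempty set. *)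
Lemma extent_ge (E : lmodType C) (D : set E) m (c : 'I_m -> C) (d : 'I_m -> E) r :
  (forall j, D (d j)) ->
  (forall m' (c' : 'I_m' -> C) (d' : 'I_m' -> E), (forall j, D (d' j)) ->
     \sum_j c' j *: d' j = \sum_j c j *: d j -> r <= l1norm c' ^+ 2) ->
  r <= extent D (\sum_j c j *: d j).
Proof.
move=> Dd H; apply: lb_le_inf; first by exists (l1norm c ^+ 2), m, c, d.
by move=> _ [m' [c' [d' [Dd' e ->]]]]; apply: (H _ _ d').
Qed.

Definition gaussian_dec n (U : qop R n) (l : R) := exists m (c : 'I_m -> C) K,
  [/\ forall j, gaussian_unitary (K j : qop R n), U = \sum_j c j *: K j & l1norm c = l].

Lemma gaussian_dec_qt m n (U : qop R m) (V : qop R n) a b :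
  gaussian_dec U a -> gaussian_dec V b -> gaussian_dec (qt U V) (a * b).
Proof.
move=> [p [c [K [gK -> <-]]]] [q [d [L [gL -> <-]]]].
exists (p * q)%N, (fun k => c (mxtens_unindex k).1 * d (mxtens_unindex k).2),
  (fun k => qt (K (mxtens_unindex k).1) (L (mxtens_unindex k).2)); split=> [j||].
- exact: gaussian_qt.
- have qt_suml (A : 'I_p -> qop R m) (B : qop R n) : qt (\sum_j A j) B = \sum_j qt (A j) B.
    exact: (big_morph (fun X => qt X B) (fun X Y => qtDl X Y B) (qt0l m B)).
  have qt_sumr (A : qop R m) (B : 'I_q -> qop R n) : qt A (\sum_j B j) = \sum_j qt A (B j).
    exact: (big_morph (qt A) (qtDr A) (qt0r n A)).
  rewrite qt_suml [RHS](reindex (@mxtens_index p q)); last first.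
    by exists (@mxtens_unindex p q) => k _; rewrite ?mxtens_indexK ?mxtens_unindexK.
  rewrite (eq_bigr (fun x => (c x.1 * d x.2) *: qt (K x.1) (L x.2))) => [|x _]; last first.
    by rewrite mxtens_indexK.
  rewrite -(pair_bigA _ (fun i j => (c i * d j) *: qt (K i) (L j))) /=.
  apply: eq_bigr => i _; rewrite qt_sumr; apply: eq_bigr => j _.
  by rewrite qtZl qtZr scalerA.
rewrite /l1norm mulr_sum; apply: eq_bigr => k _; exact: ComplexField.Normc.normcM.
Qed.

Lemma gaussian_dec_pk m n (U : qop R m) (V : qop R n) l :
  m = n -> pk U = pk V -> gaussian_dec U l -> gaussian_dec V l.
Proof. by move=> mn; case: n / mn V => V /pk_inj ->. Qed.

Lemma gaussian_dec_pow n (V : qop R n) l t :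
  gaussian_dec V l -> gaussian_dec (tens_pow V t) (l ^+ t).
Proof.
move=> dV; elim: t => [|t IH].
  apply: (@gaussian_dec_pk 0 (n * 0) 1%:M); rewrite ?muln0 ?pk_tens_pow //.
  exists 1%N, (fun=> 1), (fun=> 1%:M); split=> [j||]; first exact: gaussian_one.
    by rewrite big_ord1 scale1r.
  by rewrite /l1norm big_ord1; exact: ComplexField.Normc.normc1.
apply: (@gaussian_dec_pk (n + n * t) (n * t.+1) (qt V (tens_pow V t))).
- by rewrite mulnS.
- by rewrite pk_tens_powS.
by rewrite exprS; apply: gaussian_dec_qt.
Qed.

Lemma unitary_extent_le n (U : qop R n) l :
  gaussian_dec U l -> unitary_extent U <= l ^+ 2.
Proof. by move=> [m [c [K [gK -> <-]]]]; apply: extent_le. Qed.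

Lemma tens_powM n (A B : qop R n) t : tens_pow (A *m B) t = tens_pow A t *m tens_pow B t.
Proof.
rewrite /tens_pow -castmx_sq_mul; congr castmx.
case: t => [|t]; first by rewrite /ntensmx mulmx1.
by elim: t => [|t IH] //; rewrite !ntensmxS IH tensmx_mul.
Qed.

Lemma mxtrace_tens_pow n (A : qop R n) t : \tr (tens_pow A t) = (\tr A) ^+ t.
Proof.
rewrite /tens_pow castmx_tr; case: t => [|t]; first exact: mxtrace1.
by elim: t => [|t IH] //; rewrite ntensmxS mxtrace_tens IH -exprS.
Qed.

Lemma aligned_phase (a b : C) : exists2 z : C, `|z| <= 1 & `|a + z * b| = `|a| + `|b|.
Proof.
have [->|a0] := eqVneq a 0; first by exists 1; rewrite ?normr1 // add0r mul1r normr0 add0r.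
have [->|b0] := eqVneq b 0; first by exists 1; rewrite ?normr1 // mulr0 normr0 !addr0.
have na0 : `|a| != 0 by rewrite normr_eq0.
have nb0 : `|b| != 0 by rewrite normr_eq0.
(* The phase of [a] times the inverse phase of [b]. *)
exists (a / `|a| * (`|b| / b)).
  by rewrite normrM !normf_div !normr_id !divff // mulr1.
have -> : a + a / `|a| * (`|b| / b) * b = a / `|a| * (`|a| + `|b|) by field; rewrite na0 b0.
by rewrite normrM normf_div normr_id divff // mul1r ger0_norm // addr_ge0.
Qed.

(** One number [l] serves both sides: a decomposition of [V] attains it, and the witness shows for
    every [t] that no decomposition of the power has norm below [l ^+ t]. *)
Lemma fermionic_extent (V : qop R 2) : V \is unitarymx -> fermionic2 V ->
  exists2 l : R, gaussian_dec V l & forall t, l ^+ (2 * t) <= unitary_extent (tens_pow V t).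
Proof.
move=> uV fV; have [G [a [b [gG VE]]]] := fermionic_decomposition uV fV.
pose cc (j : 'I_2) : C := if j == 0 then a else b.
pose KK (j : 'I_2) : qop R 2 := if j == 0 then G else G *m zz R.
have gzz : gaussian_unitary (zz R).
  apply: gaussian_span => [|k]; first exact: zz_unitary.
  exists (- delta_mx 0 k); rewrite gamN gam_delta zz_parity.
  by rewrite mulNmx -parity_majorana.
have dV : gaussian_dec V (l1norm cc).
  exists 2%N, cc, KK; split=> [j||]; last by [].
    by rewrite /KK; case: ifP => _; [exact: gG | exact: (gaussian_mul gG gzz)].
  rewrite VE !big_ord_recl big_ord0 addr0 /cc /KK /= mulmxDr mul_mx_scalar.
  by rewrite -scalemxAr.
exists (l1norm cc) => // t.
have [m [c [K [gK e _]]]] := gaussian_dec_pow t dV.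
rewrite /unitary_extent e; apply: extent_ge => // m' c' K' gK'; rewrite -e => e'.
have [z z1 zab] := aligned_phase a b.
pose W := tens_pow (1%:M + z *: zz R) t; pose H := tens_pow (adjoint G) t.
have trW : `|(\tr (W *m (H *m tens_pow V t)) : C)| = (4 * l1norm cc)%:C ^+ t.
  rewrite /W /H -!tens_powM mxtrace_tens_pow normrX; congr (_ ^+ t).
  rewrite VE [adjoint G *m _]mulmxA unitary_adjl ?mul1mx; last by case: gG.
  have zz1 : zz R *m zz R = 1%:M by rewrite zz_parity parityM.
  have tr0 : \tr (zz R) = 0.
    by rewrite /zz mxtrace_tens /mxtrace !big_ord_recl !big_ord0 !mxE /= subr0 sub0r addr0 subrr mul0r.
  have -> : \tr ((1%:M + z *: zz R) *m (a%:M + b *: zz R)) = 4 * (a + z * b).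
    (* Only the multiples of the identity, [a] and [z b], survive the trace, since [zz] has trace 0
       and square 1. *)
    rewrite mulmxDl mul1mx mulmxDr mul_mx_scalar -scalemxAl -scalemxAr scalerA zz1.
    rewrite !mxtraceD !mxtraceZ mxtrace_scalar mxtrace1 tr0 -mulr_natr; ring.
  rewrite normrM zab rmorphM /= l1normE !big_ord_recl big_ord0 addr0 /cc /=.
  by rewrite rmorph_nat normr_nat.
have trK j : `|(\tr (W *m (H *m K' j)) : C)| <= 4 ^+ t.
  have /gaussianP[uHK [O HKO]] : gaussian_unitary (H *m K' j).
    by apply: gaussian_mul (gK' j); apply: gaussian_tens_pow; apply: gaussian_adjoint.
  (* [H] is Gaussian, so [H *m K' j] is as well; with [k = 0] no block weight remains. *)
  have := @witness_bound R z z1 t 0 _ W (H *m K' j) O erefl.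
  rewrite big_ord0 mul1r rmorphXn rmorph_nat; apply => //.
  by rewrite p1t.
have : (4 * l1norm cc)%:C ^+ t <= (l1norm c')%:C * 4 ^+ t.
  rewrite -trW -e' !mulmx_sumr raddf_sum l1normE mulr_suml.
  apply: le_trans (ler_norm_sum _ _ _) _; apply: ler_sum => j _.
  by rewrite -!scalemxAr /= mxtraceZ normrM ler_wpM2l.
have -> : (4 : C) = (4 : R)%:C by rewrite rmorph_nat.
rewrite -!(rmorphXn (real_complex R)) -(rmorphM (real_complex R)) lecR exprMn mulrC ler_pM2r ?exprn_gt0 //.
by rewrite mulnC exprM; apply: lerXn2r; rewrite nnegrE ?exprn_ge0 // l1norm_ge0.
Qed.

End Extents.

Theorem lemma17 (R : realType) (V : qop R 2) (chi : nat)
    (c : 'I_chi -> R[i]) (K : 'I_chi -> qop R 2)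
    (V_unitary : V \is unitarymx) (V_fermionic : fermionic2 V)
    (K_gaussian : forall j, gaussian_unitary (K j))
    (v_dec : act_middle V *m bell_pair_state R
             = \sum_j c j *: (act_middle (K j) *m bell_pair_state R)) :
  (forall t : nat,
     tens_pow V t = tens_pow (\sum_j c j *: K j) t
     /\ unitary_extent (tens_pow V t) <= l1norm c ^+ (2 * t))
  /\
  (state_extent (act_middle V *m bell_pair_state R : qvec R 4)
     = l1norm c ^+ 2 ->
   unitary_extent V
     = state_extent (act_middle V *m bell_pair_state R : qvec R 4)
   /\ forall t : nat,
        unitary_extent (tens_pow V t) = unitary_extent V ^+ t).
Proof.
have act_sum m (d : 'I_m -> R[i]) (L : 'I_m -> qop R 2) :
    act_middle (\sum_j d j *: L j) *m bell_pair_state R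
    = \sum_j d j *: (act_middle (L j) *m bell_pair_state R).
  have actD a (A B : qop R 2) : act_middle (a *: A + B) = a *: act_middle A + act_middle B.
    by rewrite /act_middle tensmxDr tensmxDl tensmxZr tensmxZl.
  have act0 : act_middle (0 : qop R 2) = 0 by rewrite /act_middle tensmx0 tens0mx.
  elim/big_rec2: _ => [|j A v _ <-]; first by rewrite act0 mul0mx.
  by rewrite actD mulmxDl scalemxAl.
have VK : V = \sum_j c j *: K j.
  by apply: act_middle_bell_inj; rewrite v_dec act_sum.
have dV : gaussian_dec V (l1norm c) by exists chi, c, K.
have ub t : unitary_extent (tens_pow V t) <= l1norm c ^+ (2 * t).
  rewrite [X in _ <= X]exprM exprAC.
  by apply: unitary_extent_le; apply: gaussian_dec_pow.
split=> [t|opt]; first by rewrite -VK.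
(* [V = \sum_j c j *: K j] gives the upper bound. Conversely, any Gaussian decomposition of [V]
   applied to the Bell pairs decomposes [|v>] into Gaussian states, so its norm is bounded below by
   the state extent. *)
have VE : unitary_extent V = l1norm c ^+ 2.
  apply/eqP; rewrite eq_le unitary_extent_le //= -opt.
  rewrite /unitary_extent {2}VK; apply: extent_ge => // m d L gL; rewrite -VK => dL.
  rewrite -dL act_sum; apply: extent_le => j.
  have [U gU <-] := bell_pair_gaussian R.
  exists (act_middle (L j) *m U); last by rewrite mulmxA.
  by apply: gaussian_mul => //; apply: act_middle_gaussian.
split=> [|t]; first by rewrite opt.
apply/eqP; rewrite eq_le VE -exprM ub /=.
have [l dl lb] := fermionic_extent V_unitary V_fermionic.
(* As [V] has a decomposition of norm [l], its extent is at most [l ^+ 2]; the [t]-th powers compare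
   likewise. *)
apply: le_trans (lb t); rewrite !exprM -VE; apply: lerXn2r.
- by rewrite nnegrE VE exprn_ge0 // l1norm_ge0.
- by rewrite nnegrE exprn_ge0 //; case: dl => m [d [L [_ _ <-]]]; apply: l1norm_ge0.
exact: unitary_extent_le.
Qed.
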